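(* The ideal $\mathfrak I_n$ of all quasi-identities of $M_n$ is finitely generated as a T-ideal of $\mathcal C\langle X\rangle$, by elements each of which depends on at most $2n^2$ of the variables $x_k$ (and their coordinates $x^{(k)}_{ij}$).
   Context: $F$ is a field of characteristic $0$, $n\ge1$, $M_n=M_n(F)$, $\mathcal C=F[x^{(k)}_{ij}:1\le i,j\le n,\ k\ge1]$, $X=\{x_1,x_2,\dots\}$ noncommuting; $\mathcal C\langle X\rangle$ is the free $\mathcal C$-algebra (quasi-polynomials). A quasi-identity of $M_n$ vanishes when each $x_k$ is replaced by any $A_k=(a^{(k)}_{ij})\in M_n$ and each $x^{(k)}_{ij}$ by $a^{(k)}_{ij}$; $\mathfrak I_n$ is the set of quasi-identities. With generic matrices $\xi_k=(x^{(k)}_{ij})\in M_n(\mathcal C)$ and $\Phi:\mathcal C\langle X\rangle\to M_n(\mathcal C)$ the $\mathcal C$-algebra map with $x_k\mapsto\xi_k$, a T-ideal is an ideal closed under all simultaneous substitutions $x_k\mapsto H_k$, $x^{(k)}_{ij}\mapsto\Phi(H_k)_{ij}$ ($H_k\in\mathcal C\langle X\rangle$); the T-ideal generated by a set is the smallest T-ideal containing it. *)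

(* Defs.v *)
From Stdlib Require List.
From HB Require Import structures.
From mathcomp Require Import all_boot all_order all_algebra.
Set Implicit Arguments. Unset Strict Implicit. Unset Printing Implicit Defensive.
Import GRing.Theory.
Local Open Scope ring_scope.

(* Syntactic quasi-polynomials: terms of the free C-algebra C<X>, where
   C = F[x^(k)_ij : k, i, j < n].
   QVar k        = the noncommuting variable x_k
   QCoord k i j  = the commuting variable x^(k)_ij
   QConst c      = the constant c in F. *)
Inductive qterm (F : Type) (n : nat) : Type :=
| QVar of nat
| QCoord of nat & 'I_n & 'I_n
| QConst of F
| QAdd of qterm F n & qterm F n
| QMul of qterm F n & qterm F n.

Arguments QVar {F n}.
Arguments QCoord {F n}.
Arguments QConst {F n}.
Arguments QAdd {F n}.
Arguments QMul {F n}.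

Section QPoly.
Variables (F : fieldType) (n : nat).

(* A basis monomial of C<X>: (commutative monomial, noncommutative word).
   The commutative monomial is a list of coordinate variables (k,i,j),
   considered up to permutation. *)
Definition cmon := seq (nat * 'I_n * 'I_n).
Definition word := seq nat.

Fixpoint qexpand (t : qterm F n) : seq (cmon * word * F) :=
  match t with
  | QVar k => [:: ([::], [:: k], 1)]
  | QCoord k i j => [:: ([:: (k, i, j)], [::], 1)]
  | QConst c => [:: ([::], [::], c)]
  | QAdd a b => qexpand a ++ qexpand b
  | QMul a b => [seq (e1.1.1 ++ e2.1.1, e1.1.2 ++ e2.1.2, e1.2 * e2.2)
                  | e1 <- qexpand a, e2 <- qexpand b]
  end.

Definition qcoef (t : qterm F n) (c : cmon) (w : word) : F :=
  \sum_(e <- qexpand t | perm_eq e.1.1 c && (e.1.2 == w)) e.2.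

Definition qeq (t1 t2 : qterm F n) : Prop :=
  forall (c : cmon) (w : word), qcoef t1 c w = qcoef t2 c w.

Definition qsum (s : seq (qterm F n)) : qterm F n := foldr QAdd (QConst 0) s.

(* Phi : C<X> -> M_n(C), x_k |-> generic matrix xi_k; entry (i,j) of Phi(t). *)
Fixpoint qphi (t : qterm F n) : 'I_n -> 'I_n -> qterm F n :=
  match t with
  | QVar k => fun i j => QCoord k i j
  | QCoord k a b => fun i j => if i == j then QCoord k a b else QConst 0
  | QConst c => fun i j => if i == j then QConst c else QConst 0
  | QAdd a b => fun i j => QAdd (qphi a i j) (qphi b i j)
  | QMul a b => fun i j =>
      qsum [seq QMul (qphi a i l) (qphi b l j) | l <- enum 'I_n]
  end.

Fixpoint qsubst (H : nat -> qterm F n) (t : qterm F n) : qterm F n :=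
  match t with
  | QVar k => H k
  | QCoord k i j => qphi (H k) i j
  | QConst c => QConst c
  | QAdd a b => QAdd (qsubst H a) (qsubst H b)
  | QMul a b => QMul (qsubst H a) (qsubst H b)
  end.

Fixpoint qeval (A : nat -> 'M[F]_n) (t : qterm F n) : 'M[F]_n :=
  match t with
  | QVar k => A k
  | QCoord k i j => (A k i j)%:M
  | QConst c => c%:M
  | QAdd a b => qeval A a + qeval A b
  | QMul a b => qeval A a *m qeval A b
  end.

Definition quasi_identity (t : qterm F n) : Prop :=
  forall A : nat -> 'M[F]_n, qeval A t = 0.

Fixpoint qvars (t : qterm F n) : seq nat :=
  match t with
  | QVar k => [:: k]
  | QCoord k _ _ => [:: k]
  | QConst _ => [::]
  | QAdd a b => qvars a ++ qvars b
  | QMul a b => qvars a ++ qvars b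
  end.

Definition is_Tideal (I : qterm F n -> Prop) : Prop :=
  [/\ forall a b, qeq a b -> I a -> I b,
      I (QConst 0),
      forall a b, I a -> I b -> I (QAdd a b),
      (forall a b, I b -> I (QMul a b)) /\ (forall a b, I a -> I (QMul a b))
    & forall (H : nat -> qterm F n) a, I a -> I (qsubst H a)].

Definition Tgen (S : qterm F n -> Prop) (t : qterm F n) : Prop :=
  forall I, is_Tideal I -> (forall s, S s -> I s) -> I t.

End QPoly.

(* Main.v *)
Require Import Defs.
From Stdlib Require List.
From Stdlib Require Import Classical.
From mathcomp Require Import all_boot all_order all_algebra all_fingroup.
Set Implicit Arguments. Unset Strict Implicit. Unset Printing Implicit Defensive.
Import GRing.Theory Order.TTheory Num.Theory.
Local Open Scope ring_scope.

(** Put N = n^2.  In the group algebra of S_m, the identity is a combination of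
    alternating sums over r + 1 letters and of indicators of the sets
    {pi | mu o pi = la}, where mu and la are colourings with r colours.

    For m = N + 1 and r = n this yields, following Razmyslov, a quasi-identity
    expressing x_1 ... x_N through shorter words with coefficients in C, so modulo
    its T-ideal every quasi-polynomial only has words of length < N.

    For r = 2 N, alternating sums over r + 1 letters kill such quasi-polynomials: a
    word absorbs fewer than N letters, and among more than N coordinates two have
    the same position (i, j).  The other summands show that a quasi-identity follows
    by polarisation from quasi-identities in 2 N letters.

    Those with words of length < N form a submodule of a free module of finite
    rank over a polynomial ring in finitely many variables, which is finitely
    generated by Hilbert's basis theorem. *)

(** * Alternating sums in the group algebra of the symmetric group *)

(** The spanning statement for S_m has a representation-theoretic reason: alternating sums over r +
    1 letters generate the blocks of shapes with more than r rows, and the indicators, which are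
    empty or cosets of Young subgroups with at most r parts, generate the others. The argument below
    needs only positivity: a rational function orthogonal to both families is orthogonal to itself.
    Clearing denominators then makes the identity available over every F of characteristic 0.

    Computing with terms modulo [qeq] directly is awkward. Equalities in C<X> are instead proved by
    evaluation: coordinates and noncommuting variables are specialised independently, the latter to
    square matrices of every size, and over an infinite field this determines [qeq].
    Quasi-identities are tested by the coupled evaluation only.

    In a monomial, coordinates and noncommuting letters alike occupy slots. S_m permutes the letter
    labels over the slots; since a substitution changes x_k together with its coordinates, this
    action is what polarisation can produce inside a T-ideal. *)

Lemma sum_sign_reversing (F : fieldType) (V : lmodType F) (I : finType)
    (P : pred I) (i : I -> I) (h : I -> V) :
  (2%:R : F) != 0 -> involutive i -> (forall x, P (i x) = P x) ->
  (forall x, P x -> h (i x) = - h x) -> \sum_(x | P x) h x = 0.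
Proof.
move=> n2 iK Pi hi; set S := LHS.
have SN : S = - S.
  rewrite {1}/S (reindex_inj (inv_inj iK)) /= (eq_bigl P) // -sumrN.
  exact: eq_bigr.
have : (2%:R : F) *: S = 0 by rewrite scaler_nat mulr2n {1}SN addNr.
by move/eqP; rewrite scaler_eq0 (negPf n2) /= => /eqP.
Qed.

Lemma tperm_Sym (T : finType) (Y : {set T}) (a b : T) :
  a \in Y -> b \in Y -> tperm a b \in Sym Y.
Proof.
move=> aY bY; rewrite inE; apply/subsetP => x; rewrite inE.
by case: tpermP => [-> _|-> _|_ _]; rewrite ?eqxx.
Qed.

Lemma Sym_mulr (T : finType) (Y : {set T}) (s t : {perm T}) :
  t \in Sym Y -> ((s * t)%g \in Sym Y) = (s \in Sym Y).
Proof. by move=> tY; rewrite (groupMr s (G := Sym_group Y) tY). Qed.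

Lemma Sym_mull (T : finType) (Y : {set T}) (s t : {perm T}) :
  t \in Sym Y -> ((t * s)%g \in Sym Y) = (s \in Sym Y).
Proof. by move=> tY; rewrite (groupMl s (G := Sym_group Y) tY). Qed.

Lemma pigeonhole_pair (T U : finType) (Y : {set T}) (B : {set U}) (f : T -> U) :
  (forall a, a \in Y -> f a \in B) -> (#|B| < #|Y|)%N ->
  exists a b, [/\ a \in Y, b \in Y, a != b & f a = f b].
Proof.
move=> fB lt.
case: (boolP [exists a in Y, exists b in Y, (a != b) && (f a == f b)]).
  case/exists_inP => a aY /exists_inP [b bY /andP [ab /eqP fab]].
  by exists a, b.
move=> no; suff inj : {in Y &, injective f}.
  have /subset_leq_card : f @: Y \subset B by apply/subsetP => _ /imsetP[a /fB ? ->].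
  by rewrite card_in_imset // leqNgt lt.
move=> a b aY bY fab; apply/eqP; apply: contraNT no => ab.
by apply/exists_inP; exists a => //; apply/exists_inP; exists b; rewrite ?ab ?fab /=.
Qed.

(** Greedy colouring. The positions of [D] with no earlier larger value form an increasing sequence
    and receive colour [r]. The other positions form [D']; a decreasing chain in [D'] extends at the
    front by the element witnessing that its head lies in [D']. *)
Lemma decreasing_or_colouring m (s : 'I_m -> nat) r (D : {set 'I_m}) :
  injective s ->
  (exists c : seq 'I_m, [/\ size c = r.+1, {subset c <= D} &
     sorted (fun a b : 'I_m => (a < b)%N && (s b < s a)%N) c]) \/
  (exists col : 'I_m -> nat, (forall k, k \in D -> (col k < r)%N) /\
     forall k l : 'I_m, k \in D -> l \in D -> (k < l)%N -> col k = col l ->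
       (s k < s l)%N).
Proof.
move=> sI; elim: r D => [|r IH] D.
  case: (set_0Vmem D) => [->|[k kD]].
    by right; exists (fun=> 0%N); split=> k; rewrite inE.
  by left; exists [:: k]; split=> // x; rewrite inE => /eqP->.
pose D' := [set k in D | [exists j in D, (j < k)%N && (s k < s j)%N]].
have sD : D' \subset D by apply/subsetP => k; rewrite inE => /andP[].
case: (IH D') => [[c [sc cD cs]]|[col [colr colI]]].
  left; case: c sc cD cs => // k c [sc] cD cs.
  have := cD k (mem_head _ _); rewrite inE => /andP[kD /exists_inP[j jD jk]].
  exists (j :: k :: c); split=> //=; first by rewrite sc.
    by move=> x; rewrite inE => /orP[/eqP->//|/cD]; apply/subsetP.
  by rewrite jk.
right; exists (fun k => if k \in D' then col k else r); split=> [k kD|k l kD lD kl].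
  by case: ifP => // /colr /ltnW.
case: ifP => kD'; case: ifP => lD' e.
- exact: colI.
- by have := colr _ kD'; rewrite e ltnn.
- by have := colr _ lD'; rewrite -e ltnn.
rewrite ltn_neqAle; apply/andP; split.
  by apply/eqP => /sI kle; rewrite kle ltnn in kl.
rewrite leqNgt; apply: contraFN lD' => lsk; rewrite inE lD /=.
by apply/exists_inP; exists k => //; rewrite kl.
Qed.

Definition lexkey m (s : 'S_m) : m.-tuplelexi nat := [tuple (s k : nat) | k < m].

Lemma lexkey_lt m (s t : 'S_m) :
  (exists2 k : 'I_m, forall i : 'I_m, (i < k)%N -> s i = t i & (s k < t k)%N) ->
  (lexkey s < lexkey t)%O.
Proof.
case=> k H lt; apply/ltxi_tuplePlt; exists k => [i ik|].
  by rewrite !tnth_mktuple H.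
by rewrite !tnth_mktuple.
Qed.

Lemma first_moved m (t : 'S_m) : t != 1%g ->
  exists2 k : 'I_m, forall i : 'I_m, (i < k)%N -> t i = i & t k != k.
Proof.
move=> t1; have [k0 k0P] : exists k, t k != k.
  apply/existsP; apply: contraNT t1; rewrite negb_exists => /forallP H.
  by apply/eqP/permP => k; rewrite perm1; apply/eqP; rewrite -[_ == _]negbK.
case: (@arg_minnP _ k0 (fun k => t k != k) (fun k : 'I_m => k : nat) k0P) => k kP kmin.
exists k => // i ik; apply/eqP; apply: contraLR ik => /kmin.
by rewrite -leqNgt.
Qed.

Lemma first_moved_up m (t : 'S_m) (k : 'I_m) :
  (forall i : 'I_m, (i < k)%N -> t i = i) -> t k != k -> (k < t k)%N.
Proof.
move=> H tk; rewrite ltn_neqAle eq_sym tk /= leqNgt; apply/negP => lt.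
by have /perm_inj tkk := H _ lt; rewrite tkk eqxx in tk.
Qed.

Definition alternating_null (F : fieldType) (V : lmodType F) m r (g : 'S_m -> V) :=
  forall (rho : 'S_m) (Y : {set 'I_m}), #|Y| = r.+1 ->
    \sum_(t in Sym Y) (-1) ^+ t *: g (t * rho)%g = 0.

Definition carries m r (mu la : {ffun 'I_m -> 'I_r}) (s : 'S_m) :=
  [forall k, mu (s k) == la k].

Lemma carries_alternating_null m r (mu la : {ffun 'I_m -> 'I_r}) :
  @alternating_null rat rat^o m r (fun s => (carries mu la s)%:R).
Proof.
move=> rho Y cY.
have [//||a [b [aY bY ab fab]]] := @pigeonhole_pair _ _ Y setT (fun k => mu (rho k)).
  by rewrite cardsT card_ord cY.
rewrite /= in fab.
apply: (@sum_sign_reversing _ _ _ _ (fun t => (t * tperm a b)%g)) => //.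
- by move=> t; rewrite -mulgA tperm2 mulg1.
- by move=> t; rewrite Sym_mulr // tperm_Sym.
move=> t _; rewrite odd_permM odd_tperm ab addbT signrN scaleNr.
congr (- (_ *: _%:R)); congr nat_of_bool; apply: eq_forallb => k.
by rewrite !permM; case: tpermP => // ->; rewrite fab.
Qed.

(* Let s be the lexicographically least permutation in the support of g.  It has
   no decreasing subsequence of length r + 1, for otherwise the alternating
   condition expresses g s through smaller permutations; so the positions can be
   coloured with r colours so that s increases on each colour.  Subtracting from
   g a multiple of the corresponding indicator [carries] moves the least element
   of the support up. *)
Lemma orthogonal_alternating_null m r (f g : 'S_m -> rat) :
  (forall mu la : {ffun 'I_m -> 'I_r}, \sum_(s | carries mu la s) f s = 0) ->
  @alternating_null rat rat^o m r g -> \sum_s f s * g s = 0.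
Proof.
move=> fP.
(* The induction measure: the permutations lexicographically at or above some element of the
   support. Subtracting the indicator removes [s] from this set, although the support itself may
   grow. *)
pose up (h : 'S_m -> rat) :=
  [set s | [exists t, (h t != 0) && (lexkey t <= lexkey s)%O]].
have [k] := ubnP #|up g|; elim: k g => // k IH g gk gA.
case: (boolP [exists s, g s != 0]) => [/existsP[s1 s1P]|no]; last first.
  rewrite big1 // => s _; move: no; rewrite negb_exists => /forallP/(_ s).
  by rewrite negbK => /eqP->; rewrite mulr0.
case: (@arg_minP _ _ _ s1 (fun s => g s != 0) (@lexkey m)) => // s sP smin.
have least t : (lexkey t < lexkey s)%O -> g t = 0.
  by move=> ts; apply/eqP; apply: contraTT ts => /smin; rewrite -leNgt.
have sI : injective (fun k : 'I_m => (s k : nat)).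
  by move=> a b /ord_inj/perm_inj.
case: (@decreasing_or_colouring m _ r setT sI).
  case=> c [sc _ cs]; case/eqP: sP.
  have tr : transitive (fun a b : 'I_m => (a < b)%N && (s b < s a)%N).
    move=> y x z /andP[xy yx] /andP[yz zy].
    by rewrite (ltn_trans xy yz) (ltn_trans zy yx).
  have uc : uniq c by apply: (sorted_uniq tr) cs => x /=; rewrite ltnn.
  have dec (a b : 'I_m) : a \in c -> b \in c -> (a < b)%N -> (s b < s a)%N.
    move=> ac bc ab.
    have := sorted_ltn_nth tr a cs.
    move=> /(_ (index a c) (index b c)); rewrite !inE !index_mem ac bc !nth_index //.
    case: (ltngtP (index a c) (index b c)) => [_ /(_ isT isT isT)/andP[]//| |].
      move=> ba _; have := sorted_ltn_nth tr a cs.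
      move=> /(_ (index b c) (index a c)); rewrite !inE !index_mem ac bc !nth_index //.
      by move=> /(_ isT isT ba)/andP[ba' _]; rewrite ltnNge ltnW in ab.
    move=> e; have : nth a c (index a c) = nth a c (index b c) by rewrite e.
    by rewrite !nth_index // => eab; rewrite eab ltnn in ab.
  have := gA s [set x in c]; rewrite cardsE (card_uniqP uc) sc => /(_ erefl).
  rewrite (bigD1 1%g) /=; last exact: (group1 (Sym_group _)).
  rewrite big1 ?addr0 ?odd_perm1 ?expr0 ?scale1r ?mul1g // => t /andP[tc t1].
  have [j jlt tj] := first_moved t1.
  rewrite least ?scaler0 //; apply: lexkey_lt; exists j => [i ij|].
    by rewrite permM jlt.
  have jc : j \in c.
    by move: tc; rewrite inE => /subsetP/(_ j); rewrite !inE => /(_ tj).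
  rewrite permM; apply: dec => //; last exact: first_moved_up.
  by move: tc; rewrite inE => /perm_closed-/(_ j); rewrite !inE => ->.
case=> col [colr colI].
have colr' k' : (col k' < r)%N by apply: colr; rewrite inE.
(* [mu] is [la] transported by [s], so [s] is carried. Any other carried [t] is [u * s] with [u]
   preserving colours; at its first moved position [u] goes up within a colour on which [s]
   increases, so [t] is lexicographically larger. *)
pose la := [ffun k' : 'I_m => Ordinal (colr' k')].
pose mu := [ffun k' : 'I_m => la ((s^-1)%g k')].
have carS : carries mu la s.
  by apply/forallP => k'; rewrite !ffunE permK.
have carU t : carries mu la t -> t != s -> (lexkey s < lexkey t)%O.
  move=> /forallP ct ts; pose u := (t * s^-1)%g.
  have u1 : u != 1%g by rewrite /u -eq_mulgV1.
  have tu : t = (u * s)%g by rewrite /u mulgKV.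
  have [j jlt uj] := first_moved u1.
  apply: lexkey_lt; exists j => [i ij|]; first by rewrite tu permM jlt.
  rewrite tu permM; apply: colI; rewrite ?inE //; first exact: first_moved_up.
  have := ct j; rewrite !ffunE tu permM permK => /eqP /(congr1 val) /= ->.
  by [].
pose g' t := g t - g s * (carries mu la t)%:R.
have -> : \sum_t f t * g t = \sum_t f t * g' t.
  have e : \sum_t g s * (if carries mu la t then f t else 0) = 0.
    by rewrite -mulr_sumr -big_mkcond fP mulr0.
  rewrite -[LHS]subr0 -[X in _ - X]e -sumrB; apply: eq_bigr => t _.
  by rewrite /g' mulrBr mulrCA; case: carries; rewrite ?mulr1 ?mulr0.
have g'P t : g' t != 0 -> (lexkey s < lexkey t)%O.
  rewrite /g'; case: (eqVneq t s) => [->|ts]; first by rewrite carS mulr1 subrr eqxx.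
  case: (boolP (carries mu la t)) => [ct _|ct]; first exact: carU.
  rewrite mulr0 subr0 => gt; rewrite lt_neqAle smin // andbT.
  apply: contra ts => /eqP e; apply/eqP/permP => i; apply: ord_inj.
  by have := congr1 (fun z => tnth z i) e; rewrite !tnth_mktuple.
apply: IH; last first.
  move=> rho Y cY.
  under eq_bigr => t _ do rewrite /g' scalerBr.
  rewrite sumrB gA //; under eq_bigr => t _.
    rewrite -[_ *: (_ * _)]/((-1) ^+ t * (g s * (carries mu la (t * rho)%g)%:R)).
    rewrite mulrCA; over.
  rewrite -mulr_sumr.
  have /= := @carries_alternating_null m r mu la rho Y cY.
  by move=> H; rewrite [X in g s * X]H mulr0 subrr.
apply: (leq_trans (n := #|up g|)); last by rewrite -ltnS.
apply: proper_card; apply/properP; split.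
  apply/subsetP => t; rewrite !inE => /existsP[u /andP[/g'P su ut]].
  by apply/existsP; exists s; rewrite sP /= (le_trans (ltW su)).
exists s; first by rewrite inE; apply/existsP; exists s; rewrite sP lexx.
rewrite inE negb_exists; apply/forallP => t; rewrite negb_and negbK.
case: eqP => //= /eqP /g'P; by rewrite ltNge.
Qed.

(** The hypothesis says that the matrix of the [a i t] has trivial kernel, so its rows span
    everything, in particular the unit vector at [t0]. *)
Lemma dual_span (K : fieldType) (I T : finType) (a : I -> T -> K) (t0 : T) :
  (forall v : T -> K, (forall i, \sum_t a i t * v t = 0) -> forall t, v t = 0) ->
  exists b : I -> K, forall t, \sum_i b i * a i t = (t == t0)%:R.
Proof.
move=> inj; pose A : 'M[K]_(#|I|, #|T|) := \matrix_(i, j) a (enum_val i) (enum_val j).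
have rf : row_full A.
  rewrite /row_full -mxrank_tr -[_ == _]/(row_free A^T) -kermx_eq0; apply/rowV0P => v.
  move/sub_kermxP => vA; apply/rowP => j; rewrite mxE.
  rewrite -[j]enum_valK; apply: (inj (fun t => v 0 (enum_rank t))) => i.
  have /rowP/(_ (enum_rank i)) := vA; rewrite !mxE => e; rewrite -[RHS]e.
  rewrite (reindex_onto enum_val enum_rank) /=; last by move=> ? _; rewrite enum_rankK.
  apply: eq_big => [k|k _]; first by rewrite enum_valK eqxx.
  by rewrite !mxE enum_rankK enum_valK mulrC.
have [B BA] := row_fullP rf.
exists (fun i => B (enum_rank t0) (enum_rank i)) => t.
have /matrixP/(_ (enum_rank t0) (enum_rank t)) := BA; rewrite !mxE.
rewrite (inj_eq enum_rank_inj) eq_sym => <-.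
rewrite (reindex_onto enum_val enum_rank) /=; last by move=> ? _; rewrite enum_rankK.
apply: eq_big => [k|k _]; first by rewrite enum_valK eqxx.
by rewrite !mxE enum_rankK enum_valK.
Qed.

Lemma rat_common_denominator (I : finType) (b : I -> rat) :
  exists (d : int) (z : I -> int), d != 0 /\ forall i, d%:~R * b i = (z i)%:~R.
Proof.
exists (\prod_i denq (b i)).
exists (fun i => (\prod_(j | j != i) denq (b j)) * numq (b i)); split.
  by apply/prodf_neq0 => i _; exact: denq_neq0.
by move=> i; rewrite (bigD1 i) //= !intrM numqE -mulrA mulrCA (mulrC (b i)).
Qed.

Definition alt_coset m (rho : 'S_m) (Y : {set 'I_m}) (s : 'S_m) : int :=
  if (s * rho^-1)%g \in Sym Y then (-1) ^+ (s * rho^-1)%g else 0.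

(** By duality it suffices that a rational [v] orthogonal to both families vanishes. Such a [v] may
    be taken for both [f] and [g] in [orthogonal_alternating_null], so the sum of its squares is 0.
    A common denominator [d] turns the coefficients into integers. *)
Theorem perm_span m r :
  exists (d : int) (za : 'S_m -> {set 'I_m} -> int)
         (zc : {ffun 'I_m -> 'I_r} -> {ffun 'I_m -> 'I_r} -> int),
  d != 0 /\ forall s : 'S_m,
    \sum_rho \sum_(Y : {set 'I_m} | #|Y| == r.+1) za rho Y * alt_coset rho Y s
    + \sum_mu \sum_la zc mu la * (carries mu la s)%:R = d * (s == 1%g)%:R.
Proof.
pose I := ('S_m * {set 'I_m} + {ffun 'I_m -> 'I_r} * {ffun 'I_m -> 'I_r})%type.
pose a (i : I) (s : 'S_m) : int := match i with
  | inl (rho, Y) => if #|Y| == r.+1 then alt_coset rho Y s else 0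
  | inr (mu, la) => (carries mu la s)%:R end.
have [v va|b bP] := @dual_span rat I 'S_m (fun i s => (a i s)%:~R) 1%g.
  suff : \sum_s v s * v s = 0.
    move=> /eqP; rewrite psumr_eq0 => [/allP H t|t _]; last exact: sqr_ge0.
    by have := H t (mem_index_enum t); rewrite /= mulf_eq0 orbb => /eqP.
  apply: (@orthogonal_alternating_null m r) => [mu la|rho Y cY].
    rewrite -[RHS](va (inr (mu, la))) big_mkcond; apply: eq_bigr => s _ /=.
    by case: carries; rewrite ?mul1r ?mul0r.
  rewrite -[RHS](va (inl (rho, Y))) /= cY eqxx.
  rewrite (reindex_inj (mulIg rho^-1%g)) /= big_mkcond; apply: eq_bigr => s _.
  rewrite /alt_coset; case: ifP => _; last by rewrite mul0r.
  by rewrite mulgKV rmorphXn /= rmorphN1.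
have [d [z [d0 dz]]] := rat_common_denominator b.
exists d, (fun rho Y => z (inl (rho, Y))), (fun mu la => z (inr (mu, la))).
split=> // s; apply: (@intr_inj rat); rewrite rmorphM /= rmorph_nat -bP mulr_sumr.
rewrite big_sumType /= rmorphD /= !rmorph_sum /=; congr (_ + _).
  under eq_bigr => rho _ do rewrite rmorph_sum big_mkcond /=.
  rewrite pair_bigA; apply: eq_bigr => -[rho Y] _ /=.
  by case: ifP => _; rewrite ?mulr0 // mulrA dz intrM.
under eq_bigr => mu _ do rewrite rmorph_sum /=.
rewrite pair_bigA; apply: eq_bigr => -[mu la] _ /=.
by rewrite mulrA dz intrM.
Qed.

Lemma alt_coset_null (F : fieldType) (V : lmodType F) m r (psi : 'S_m -> V)
    (rho : 'S_m) (Y : {set 'I_m}) :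
  alternating_null r psi -> #|Y| = r.+1 ->
  \sum_s (alt_coset rho Y s)%:~R *: psi s = 0.
Proof.
move=> null cY; rewrite -[RHS](null rho Y cY).
rewrite (reindex_inj (mulIg rho)) /= [RHS]big_mkcond; apply: eq_bigr => t _.
rewrite /alt_coset mulgK; case: ifP => _; last by rewrite scale0r.
by rewrite rmorphXn /= rmorphN1.
Qed.

Lemma sum_alt_coset_null (F : fieldType) (V : lmodType F) m r (psi : 'S_m -> V)
    (za : 'S_m -> {set 'I_m} -> int) :
  alternating_null r psi ->
  \sum_s (\sum_rho \sum_(Y : {set 'I_m} | #|Y| == r.+1)
     za rho Y * alt_coset rho Y s)%:~R *: psi s = 0.
Proof.
move=> null; under eq_bigr => s _ do rewrite rmorph_sum /= scaler_suml.
rewrite exchange_big big1 // => rho _ /=.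
under eq_bigr => s _ do rewrite rmorph_sum /= scaler_suml.
rewrite exchange_big big1 // => Y /eqP cY /=.
under eq_bigr => s _ do rewrite intrM -scalerA.
by rewrite -scaler_sumr (alt_coset_null _ null) // scaler0.
Qed.

Lemma perm_span_null (F : fieldType) (V : lmodType F) m r (d : int) za zc
    (psi : 'S_m -> V) :
  (forall s : 'S_m,
    \sum_rho \sum_(Y : {set 'I_m} | #|Y| == r.+1) za rho Y * alt_coset rho Y s
    + \sum_mu \sum_la zc mu la * (carries mu la s)%:R = d * (s == 1%g)%:R) ->
  alternating_null r psi ->
  d%:~R *: psi 1%g =
  \sum_(mu : {ffun 'I_m -> 'I_r}) \sum_la
     (zc mu la)%:~R *: \sum_(s | carries mu la s) psi s.
Proof.
move=> span null.
have -> : d%:~R *: psi 1%g = \sum_s (d * (s == 1%g)%:R)%:~R *: psi s.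
  rewrite (bigD1 1%g) //= eqxx mulr1 big1 ?addr0 // => s /negPf->.
  by rewrite mulr0 scale0r.
under eq_bigr => s _ do rewrite -span rmorphD /= scalerDl.
rewrite big_split /= sum_alt_coset_null // add0r.
under eq_bigr => s _ do rewrite rmorph_sum /= scaler_suml.
rewrite exchange_big; apply: eq_bigr => mu _.
under eq_bigr => s _ do rewrite rmorph_sum /= scaler_suml.
rewrite exchange_big; apply: eq_bigr => la _ /=.
rewrite [in RHS]big_mkcond scaler_sumr; apply: eq_bigr => s _.
by rewrite intrM; case: carries; rewrite ?mulr1 // mulr0 scale0r scaler0.
Qed.

(** * Evaluation of quasi-polynomials *)

Section CharZero.
Variable F : fieldType.
Hypothesis F0 : [pchar F] =i pred0.

Lemma natf_neq0_char0 k : (k%:R != 0 :> F) = (k != 0)%N.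
Proof. by rewrite ((pcharf0P F).1 F0). Qed.

Lemma natf_inj_char0 : injective (fun k : nat => k%:R : F).
Proof.
suff H (i j : nat) : (i <= j)%N -> i%:R = j%:R :> F -> i = j.
  by move=> i j; case/orP: (leq_total i j) => ij e; [|symmetry]; apply: H.
move=> ij e; apply/eqP; rewrite eqn_leq ij /= -subn_eq0 -((pcharf0P F).1 F0).
by rewrite natrB // e subrr.
Qed.

Lemma poly_ext0 (p : {poly F}) : (forall t, p.[t] = 0) -> p = 0.
Proof.
move=> p0; apply/eqP; apply/negPn/negP => pn0.
have := @max_poly_roots F p [seq k%:R | k <- iota 0 (size p)] pn0.
rewrite size_map size_iota ltnn => H; have : false; last by [].
apply: H; first by apply/allP => x _; rewrite /root p0.
by rewrite (map_inj_uniq natf_inj_char0) iota_uniq.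
Qed.

Lemma perm_eq_count_split (T : eqType) (x : T) (s c : seq T) :
  perm_eq s c = (count_mem x s == count_mem x c) &&
                perm_eq (filter (predC1 x) s) (filter (predC1 x) c).
Proof.
apply/idP/idP => [sc|/andP[/eqP e /seq.permP H]].
  by rewrite (seq.permP sc) eqxx /= perm_filter.
apply/allP => y _ /=; case: (eqVneq y x) => [->|yx]; first by rewrite e.
have := H (pred1 y); rewrite !count_filter.
have e' : predI (pred1 y) (predC1 x) =1 pred1 y.
  by move=> z /=; case: eqP => //= ->.
by rewrite !(eq_count e') => ->.
Qed.

(** Induction on a list [U] of variables containing all those that occur. One variable [x] becomes
    the indeterminate of a univariate polynomial, the others stay frozen at [a]; the coefficient of
    degree [count_mem x c] involves one variable fewer. *)
Lemma poly_fun_coef0 (T : eqType) (L : seq (seq T * F)) :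
  (forall a : T -> F, \sum_(e <- L) e.2 * \prod_(x <- e.1) a x = 0) ->
  forall c, \sum_(e <- L | perm_eq e.1 c) e.2 = 0.
Proof.
move=> H c.
have [U LU] : exists U : seq T, forall e x, e \in L -> x \in e.1 -> x \in U.
  exists (flatten (map fst L)) => e x eL xe; apply/flattenP; exists e.1 => //.
  exact: map_f.
elim: U L H c LU => [|x U IH] L H c LU.
  have nil e : e \in L -> e.1 = [::].
    by case: e => -[//|y s] z /LU/(_ (mem_head _ _)).
  have := H (fun=> 0); rewrite big_seq; under eq_bigr => e eL do
    rewrite nil // big_nil mulr1; rewrite -big_seq => e.
  case: c => [|y c].
    rewrite -[RHS]e [LHS]big_seq_cond [RHS]big_seq_cond; apply: eq_bigl => z.
    by case zL: (z \in L) => //=; rewrite nil.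
  rewrite big_seq_cond big1 // => z /andP[zL].
  by rewrite nil // => /perm_size.
pose k := count_mem x c; pose f := filter (predC1 x).
pose L' := [seq (f e.1, e.2) | e <- L & count_mem x e.1 == k].
have -> : \sum_(e <- L | perm_eq e.1 c) e.2 = \sum_(e <- L' | perm_eq e.1 (f c)) e.2.
  rewrite big_map big_filter_cond /=; apply: eq_bigl => e.
  exact: perm_eq_count_split.
apply: IH => [a|e y]; last first.
  case/mapP => z; rewrite mem_filter => /andP[_ zL] -> /=.
  rewrite mem_filter => /andP[/= yx yz].
  by have := LU z y zL yz; rewrite inE (negPf yx).
pose p : {poly F} :=
  \sum_(e <- L) (e.2 * \prod_(y <- f e.1) a y) *: 'X^(count_mem x e.1).
have p0 : p = 0.
  apply: poly_ext0 => t; rewrite horner_sum.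
  pose b y := if y == x then t else a y.
  rewrite -[RHS](H b); apply: eq_bigr => e _.
  rewrite hornerZ hornerXn -mulrA; congr (_ * _).
  rewrite [RHS](bigID (pred1 x)) mulrC /= big_filter.
  congr (_ * _).
    rewrite (eq_bigr (fun=> t)) => [|y /eqP->]; last by rewrite /b eqxx.
    by rewrite big_const_seq iter_mulr_1.
  by apply: eq_bigr => y /negPf yx; rewrite /b yx.
have := congr1 (fun q : {poly F} => q`_k) p0; rewrite coef0 coef_sum => E; rewrite -[RHS]E.
rewrite big_map big_filter big_mkcond; apply: eq_bigr => e _ /=.
by rewrite coefZ coefXn eq_sym; case: eqP => _; rewrite ?mulr1 ?mulr0.
Qed.

Variable n : nat.
Implicit Types (t a b : qterm F n) (A : nat -> 'M[F]_n).

(* Evaluation with the coordinates x^(k)_ij and the variables x_k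
   specialised independently of one another. *)
Fixpoint qev d A (Z : nat -> 'M[F]_d) t : 'M[F]_d :=
  match t with
  | QVar k => Z k
  | QCoord k i j => (A k i j)%:M
  | QConst c => c%:M
  | QAdd a b => qev A Z a + qev A Z b
  | QMul a b => qev A Z a *m qev A Z b
  end.

Lemma qevD d A (Z : nat -> 'M[F]_d) a b :
  qev A Z (QAdd a b) = qev A Z a + qev A Z b.
Proof. by []. Qed.

Lemma qevM d A (Z : nat -> 'M[F]_d) a b :
  qev A Z (QMul a b) = qev A Z a *m qev A Z b.
Proof. by []. Qed.

Lemma qevC d A (Z : nat -> 'M[F]_d) c : qev A Z (QConst c) = c%:M.
Proof. by []. Qed.

Lemma qeval_qev A t : qeval A t = qev A A t.
Proof. by elim: t => //= a -> b ->. Qed.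

Lemma qev_qsum d A (Z : nat -> 'M[F]_d) s :
  qev A Z (qsum s) = \sum_(t <- s) qev A Z t.
Proof.
elim: s => [|t s IH] /=; first by rewrite big_nil raddf0.
by rewrite big_cons IH.
Qed.

Lemma qev_qphi d A (Z : nat -> 'M[F]_d) t i j :
  qev A Z (qphi t i j) = (qeval A t i j)%:M.
Proof.
elim: t i j => //= [k l h|c|a IHa b IHb|a IHa b IHb] i j.
- by rewrite !mxE; case: eqP => _ //=; rewrite mulr0n raddf0.
- by rewrite !mxE; case: eqP => _ //=; rewrite mulr0n raddf0.
- by rewrite IHa IHb mxE raddfD.
rewrite qev_qsum big_map mxE raddf_sum /= big_enum.
by apply: eq_bigr => l _; rewrite /= IHa IHb scalar_mxM.
Qed.

Lemma eq_qev d A A' (Z Z' : nat -> 'M[F]_d) t :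
  A =1 A' -> Z =1 Z' -> qev A Z t = qev A' Z' t.
Proof. by move=> eA eZ; elim: t => //= [k i j|a -> b ->|a -> b ->] //; rewrite eA. Qed.

Lemma qev_qsubst d A (Z : nat -> 'M[F]_d) H t :
  qev A Z (qsubst H t) =
  qev (fun k => qeval A (H k)) (fun k => qev A Z (H k)) t.
Proof. by elim: t => //= [k i j|a -> b ->|a -> b ->] //; rewrite qev_qphi. Qed.

Definition cval A (c : cmon n) : F := \prod_(x <- c) A x.1.1 x.1.2 x.2.
Definition wval d (Z : nat -> 'M[F]_d) (w : word) : 'M[F]_d := \prod_(k <- w) Z k.

Lemma qev_qexpand d A (Z : nat -> 'M[F]_d) t :
  qev A Z t = \sum_(e <- qexpand t) (e.2 * cval A e.1.1) *: wval Z e.1.2.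
Proof.
elim: t => /= [k|k i j|c|a -> b ->|a -> b ->].
- by rewrite big_seq1 /cval big_nil mulr1 scale1r /wval big_seq1.
- by rewrite big_seq1 /cval big_seq1 /wval big_nil mul1r /= -scalemx1.
- by rewrite big_seq1 /cval big_nil mulr1 /wval big_nil -scalemx1.
- by rewrite big_cat.
rewrite big_allpairs_dep /= mulmx_suml; apply: eq_bigr => e _.
rewrite mulmx_sumr; apply: eq_bigr => h _.
rewrite -scalemxAl -scalemxAr scalerA /cval /wval !big_cat /=; congr (_ *: _).
by rewrite mulrACA.
Qed.

(** A normal form that turns [perm_eq] into equality, so that expansions can be grouped by
    monomial. *)
Definition cmon_sort (c : cmon n) : cmon n :=
  sort (fun x y => (pickle x <= pickle y)%N) c.

Lemma cmon_sortP (c c' : cmon n) : (cmon_sort c == cmon_sort c') = perm_eq c c'.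
Proof.
apply/eqP/idP => [e|]; last first.
  move/perm_sortP; apply=> [x y|x y z|x y]; first exact: leq_total.
    exact: leq_trans.
  by rewrite -eqn_leq => /eqP/(pcan_inj pickleK).
by rewrite -(perm_sort (fun x y => (pickle x <= pickle y)%N)) -/(cmon_sort c) e
  perm_sort.
Qed.

Lemma qeq_qev t1 t2 : qeq t1 t2 ->
  forall d A (Z : nat -> 'M[F]_d), qev A Z t1 = qev A Z t2.
Proof.
move=> e12 d A Z; rewrite !qev_qexpand.
pose nf (e : cmon n * word * F) := (cmon_sort e.1.1, e.1.2).
pose K := undup (map nf (qexpand t1 ++ qexpand t2)).
have step L : {subset map nf L <= K} ->
    \sum_(e <- L) (e.2 * cval A e.1.1) *: wval Z e.1.2 =
    \sum_(k <- K) (\sum_(e <- L | nf e == k) e.2) *: (cval A k.1 *: wval Z k.2).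
  move=> LK; under [RHS]eq_bigr => k _ do rewrite scaler_suml big_mkcond.
  rewrite exchange_big /= big_seq [RHS]big_seq; apply: eq_bigr => e eL.
  rewrite -big_mkcond (eq_bigl (pred1 (nf e))); last by move=> k; rewrite /= eq_sym.
  have kK : nf e \in K by exact/LK/map_f.
  rewrite -big_filter filter_pred1_uniq ?undup_uniq // big_seq1.
  rewrite scalerA /=; congr ((_ * _) *: _); rewrite /cval.
  by apply: perm_big; rewrite perm_sym perm_sort.
rewrite !step; first last.
- by move=> k kL; rewrite mem_undup map_cat mem_cat kL.
- by move=> k kL; rewrite mem_undup map_cat mem_cat kL orbT.
rewrite big_seq [RHS]big_seq; apply: eq_bigr => k.
rewrite mem_undup => /mapP[e _ ->]; congr (_ *: _).
have := e12 e.1.1 e.1.2; rewrite /qcoef.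
under eq_bigl => h do rewrite -cmon_sortP.
under [in X in _ = X -> _]eq_bigl => h do rewrite -cmon_sortP.
by under eq_bigl => h do rewrite -xpair_eqE; under [in X in _ = X -> _]eq_bigl => h do rewrite -xpair_eqE.
Qed.

(** Labelled adjacency matrices of the path 0 -> 1 -> ... -> [size w] whose arrows carry the letters
    of [w]. The corner entry (0, [size w]) of a product along a word [u] is 1 if [u = w] and 0
    otherwise. *)
Definition path_mx (w : word) (k : nat) : 'M[F]_((size w).+1) :=
  \matrix_(a, b) ((b == a.+1 :> nat) && (nth 0%N w a == k))%:R.

Lemma wval_path_mx w u (a b : 'I_((size w).+1)) :
  wval (path_mx w) u a b = ((drop a w == u ++ drop b w) && (a + size u == b)%N)%:R.
Proof.
elim: u a => [|k u IH] a; rewrite /wval ?big_nil ?big_cons.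
  rewrite mxE addn0 /= -val_eqE /= andbC; case: eqP => //= ->.
  by rewrite eqxx.
rewrite [_ * _]/(_ *m _) mxE.
have [aw|wa] := ltnP a (size w); last first.
  rewrite [LHS]big1 => [|c _]; last first.
    rewrite mxE; case: eqP => [e|_]; last by rewrite mul0r.
    by have := ltn_ord c; rewrite e ltnS ltnNge wa.
  case: eqP => //= e; have := congr1 size e.
  by rewrite /= size_drop (eqP (_ : size w - a == 0)%N) // subn_eq0.
rewrite (bigD1 (Ordinal (aw : (a.+1 < (size w).+1)%N))) //= [X in _ + X]big1 ?addr0; last first.
  move=> c ca; rewrite mxE; case: eqP => [e|_]; last by rewrite mul0r.
  by case/eqP: ca; apply: val_inj.
have := IH (Ordinal (aw : (a.+1 < (size w).+1)%N)); rewrite /wval => ->.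
rewrite mxE eqxx /= (drop_nth 0%N aw) eqseq_cons addSnnS.
by rewrite -natrM mulnb andbA.
Qed.

(** Specialising the variables to [path_mx w] isolates the coefficient of the word [w]; this is a
    polynomial function of the coordinates, and over an infinite field it determines its
    coefficients. *)
Lemma qev_qeq t1 t2 :
  (forall d A (Z : nat -> 'M[F]_d), qev A Z t1 = qev A Z t2) -> qeq t1 t2.
Proof.
move=> H c w; rewrite /qcoef.
pose L (i : qterm F n) := [seq (e.1.1, e.2) | e <- qexpand i & e.1.2 == w].
pose L2 := [seq (e.1, - e.2) | e <- L t2].
have sums A : \sum_(e <- L t1) e.2 * cval A e.1 = \sum_(e <- L t2) e.2 * cval A e.1.
  have := H _ A (path_mx w); rewrite !qev_qexpand => /matrixP/(_ ord0 ord_max).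
  rewrite !summxE => e; rewrite !big_map !big_filter [LHS]big_mkcond [RHS]big_mkcond /=.
  have conv t : \sum_(e <- qexpand t) ((e.2 * cval A e.1.1) *: wval (path_mx w) e.1.2) ord0 ord_max
     = \sum_(e <- qexpand t) if e.1.2 == w then e.2 * cval A e.1.1 else 0.
    apply: eq_bigr => h _; rewrite mxE wval_path_mx drop0 drop_size cats0 add0n /=.
    rewrite eq_sym; case: eqP => [->|_] /=; last by rewrite mulr0.
    by rewrite eqxx mulr1.
  by rewrite -!conv.
have HH : \sum_(e <- L t1 | perm_eq e.1 c) e.2 - \sum_(e <- L t2 | perm_eq e.1 c) e.2 = 0.
  have -> : - \sum_(e <- L t2 | perm_eq e.1 c) e.2 = \sum_(e <- L2 | perm_eq e.1 c) e.2.
    by rewrite [RHS]big_map /= sumrN.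
  rewrite -big_cat; apply: poly_fun_coef0 => a.
  rewrite big_cat /= [X in _ + X]big_map /=.
  under [X in _ + X]eq_bigr => e _ do rewrite mulNr.
  rewrite sumrN.
  pose B k : 'M[F]_n := \matrix_(i, j) a (k, i, j).
  have conv t : \sum_(e <- L t) e.2 * cval B e.1 = \sum_(e <- L t) e.2 * \prod_(x <- e.1) a x.
    apply: eq_bigr => e _; congr (_ * _).
    by apply: eq_bigr => -[[k i] j] _; rewrite mxE.
  by rewrite -!conv sums subrr.
move/eqP: HH; rewrite subr_eq0 => /eqP; rewrite !big_map !big_filter_cond /=.
under eq_bigl => e do rewrite andbC.
by under [in X in _ = X -> _]eq_bigl => e do rewrite andbC.
Qed.

Lemma quasi_identity_Tideal : is_Tideal (@quasi_identity F n).
Proof.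
split.
- by move=> a b e Ha A; rewrite -[RHS](Ha A) !qeval_qev; symmetry; apply: qeq_qev.
- by move=> A; rewrite /= raddf0.
- by move=> a b Ha Hb A; rewrite /= Ha Hb addr0.
- by split=> a b H A; rewrite /= H ?mulmx0 ?mul0mx.
move=> H a Ha A; rewrite qeval_qev qev_qsubst -[RHS](Ha (fun k => qeval A (H k))).
by rewrite qeval_qev; apply: eq_qev => k //; rewrite qeval_qev.
Qed.
End CharZero.

(** * Hilbert's basis theorem *)

Section Span.
Variables (R : comNzRingType) (V : lmodType R).

Inductive lspan (G : V -> Prop) : V -> Prop :=
| lspan0 : lspan G 0
| lspan_cons c g x of G g & lspan G x : lspan G (c *: g + x).

Definition submodule (P : V -> Prop) :=
  P 0 /\ forall c x y, P x -> P y -> P (c *: x + y).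

Definition noetherian := forall P, submodule P ->
  exists s : seq V, (forall x, x \in s -> P x) /\
    forall x, P x -> lspan (fun y => y \in s) x.

Lemma lspan_sub (G H : V -> Prop) x :
  (forall y, G y -> H y) -> lspan G x -> lspan H x.
Proof.
move=> GH; elim=> [|c g y Gg _ IH]; first exact: lspan0.
by apply: lspan_cons => //; apply: GH.
Qed.

Lemma lspanD (G : V -> Prop) x y : lspan G x -> lspan G y -> lspan G (x + y).
Proof.
move=> Gx Gy; elim: Gx => [|c g z Gg _ IH]; first by rewrite add0r.
by rewrite -addrA; apply: lspan_cons.
Qed.

Lemma lspanZ (G : V -> Prop) c x : lspan G x -> lspan G (c *: x).
Proof.
elim=> [|b g z Gg _ IH]; first by rewrite scaler0; exact: lspan0.
by rewrite scalerDr scalerA; apply: lspan_cons.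
Qed.

Lemma lspan_submodule (G P : V -> Prop) x :
  submodule P -> (forall y, G y -> P y) -> lspan G x -> P x.
Proof.
move=> [P0 PD] GP; elim=> [//|c g y Gg _ Py]; apply: PD => //; exact: GP.
Qed.

End Span.

Lemma submoduleB (R : comNzRingType) (V : lmodType R) (P : V -> Prop) x y :
  submodule P -> P x -> P y -> P (x - y).
Proof.
by move=> [_ PD] Px Py; rewrite addrC -scaleN1r; apply: PD.
Qed.

(** Serves both noetherian proofs: finitely many generators of the ideal of values of [f] are lifted
    to [P], where [f] is a coordinate of a row or a coefficient of a polynomial. *)
Lemma lift_span (R : comNzRingType) (V : lmodType R) (P : V -> Prop)
    (f : V -> R) (L : R -> Prop) :
  noetherian R^o -> submodule P -> (forall c x y, f (c *: x + y) = c * f x + f y) ->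
  f 0 = 0 -> (forall a, L a -> exists2 x, P x & f x = a) -> @submodule R R^o L ->
  exists s : seq V, (forall x, x \in s -> P x) /\
    forall a, L a -> exists2 x, lspan (fun y => y \in s) x & f x = a.
Proof.
move=> nR PS fD f0 fL LS; have [s [sL Ls]] := nR L LS.
have [G [GP Gs]] : exists G : seq V, (forall x, x \in G -> P x) /\ map f G = s.
  elim: s sL {Ls} => [|a s IH] sL; first by exists [::].
  have [|G [GP Gs]] := IH; first by move=> x xs; apply: sL; rewrite inE xs orbT.
  have [x Px fx] := fL a (sL a (mem_head _ _)).
  exists (x :: G); rewrite /= fx Gs; split=> // y.
  by rewrite inE => /orP[/eqP->|/GP].
exists G; split=> // a /Ls; elim=> [|c b y bs _ [x xG <-]].
  by exists 0 => //; exact: lspan0.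
move: bs; rewrite -Gs => /mapP[g gG ->].
by exists (c *: g + x); [exact: lspan_cons | rewrite fD].
Qed.

Lemma noetherian_rV (R : comNzRingType) q : noetherian R^o -> noetherian 'rV[R]_q.
Proof.
move=> nR P PS.
(* Induction on the number [k] of leading coordinates that may be nonzero on [P]. Each step splits
   off the last of them, whose values form an ideal. *)
have fg k : (k <= q)%N -> forall P : 'rV[R]_q -> Prop, submodule P ->
  (forall x (i : 'I_q), P x -> (k <= i)%N -> x 0 i = 0) ->
  exists s : seq 'rV[R]_q, (forall x, x \in s -> P x) /\
    forall x, P x -> lspan (fun y => y \in s) x.
  elim: k => [_|k IH kq] {PS}P PS P0.
    exists [::]; split=> // x Px.
    have -> : x = 0 by apply/rowP => i; rewrite mxE P0.
    exact: lspan0.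
  pose i0 := Ordinal kq; have [PZ PD] := PS.
  pose L a := exists2 x, P x & x 0 i0 = a.
  have LS : @submodule R R^o L.
    split; first by exists 0 => //; rewrite mxE.
    move=> c a b [x Px <-] [y Py <-]; exists (c *: x + y); first exact: PD.
    by rewrite !mxE.
  have [s [sP sL]] : exists s : seq 'rV[R]_q, (forall x, x \in s -> P x) /\
      forall a, L a -> exists2 x, lspan (fun y => y \in s) x & x 0 i0 = a.
    apply: (lift_span (f := fun x : 'rV[R]_q => x 0 i0)) LS => //.
      by move=> c x y; rewrite !mxE.
    by rewrite mxE.
  pose P' x := P x /\ x 0 i0 = 0.
  have P'S : submodule P'.
    split; first by split=> //; rewrite mxE.
    move=> c x y [Px x0] [Py y0]; split; first exact: PD.
    by rewrite !mxE x0 y0 mulr0 addr0.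
  have [x i [Px x0] ki|s' [s'P s'L]] := IH (ltnW kq) P' P'S.
    move: ki; rewrite leq_eqVlt => /orP[/eqP e|]; last exact: P0.
    by have <- : i0 = i by apply: val_inj.
  exists (s ++ s'); split=> [x|x Px].
    by rewrite mem_cat => /orP[/sP//|/s'P[]].
  have [y ys yx] := sL _ (ex_intro2 _ _ x Px erefl).
  have Py : P y by apply: lspan_submodule ys.
  rewrite -(subrK y x) addrC; apply: lspanD.
    by apply: lspan_sub ys => z zs; rewrite mem_cat zs.
  apply: lspan_sub (s'L (x - y) _) => [z zs|]; first by rewrite mem_cat zs orbT.
  by split; [exact: submoduleB | rewrite !mxE yx subrr].
by apply: (fg q) => // x i _; rewrite leqNgt ltn_ord.
Qed.

Lemma hilbert_basis (R : comNzRingType) : noetherian R^o -> noetherian {poly R}^o.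
Proof.
move=> nR P PS; have [P0 PD] := PS.
have PM (p q : {poly R}) : P q -> P (p * q).
  by move=> Pq; rewrite -[_ * _]addr0; exact: (PD p).
have PA (p q : {poly R}) : P p -> P q -> P (p + q).
  by move=> Pp Pq; rewrite -[p]mul1r; exact: (PD 1).
(* [Q d] bounds the degree by [d]; the coefficients of degree [d] form the ideal [L d], which
   increases with [d] because [P] is closed under multiplication by the indeterminate. *)
pose Q d (p : {poly R}) := P p /\ (size p <= d.+1)%N.
pose L d a := exists2 p, Q d p & p`_d = a.
have QS d : @submodule R {poly R} (Q d).
  split; first by split=> //; rewrite size_poly0.
  move=> c p q [Pp sp] [Pq sq]; split; first by rewrite -mul_polyC; exact: PD.
  rewrite (leq_trans (size_polyD _ _)) // geq_max sq andbT.
  exact: leq_trans (size_scale_leq _ _) sp.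
have LS d : @submodule R R^o (L d).
  have [Q0 QD] := QS d.
  split; first by exists 0; rewrite ?coef0.
  move=> c _ _ [p Qp <-] [q Qq <-]; exists (c *: p + q); first exact: QD.
  by rewrite coefD coefZ.
have Lmono d e a : (d <= e)%N -> L d a -> L e a.
  move=> de [p [Pp sp] <-]; exists ('X^(e - d) * p); last first.
    by rewrite coefXnM ltnNge leq_subr /= subKn.
  split; first exact: PM.
  rewrite (leq_trans (size_polyMleq _ _)) // size_polyXn /=.
  by rewrite (leq_trans (leq_add (leqnn _) sp)) // addnS subnK.
(* The union of the [L d] is an ideal; its finitely many generators lie in one [L D], so the chain
   is constant from [D] on. *)
have [s [sL Ls]] : exists s : seq R^o, (forall x, x \in s -> exists d, L d x) /\
    forall x, (exists d, L d x) -> lspan (fun y => y \in s) x.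
  apply: nR; split; first by exists 0%N; case: (LS 0%N).
  move=> c x y [d Lx] [e Ly]; exists (maxn d e).
  have [_ LD] := LS (maxn d e); apply: LD.
    by apply: Lmono Lx; rewrite leq_maxl.
  by apply: Lmono Ly; rewrite leq_maxr.
have [D sD] : exists D, forall x, x \in s -> L D x.
  elim: s sL {Ls} => [|x s IH] sL; first by exists 0%N.
  have [|D sD] := IH; first by move=> y ys; apply: sL; rewrite inE ys orbT.
  have [d Ld] := sL x (mem_head _ _); exists (maxn d D) => y.
  rewrite inE => /orP[/eqP->|/sD].
    by apply: Lmono Ld; rewrite leq_maxl.
  by apply: Lmono; rewrite leq_maxr.
have LD a d : L d a -> L D a.
  move=> Ld; apply: (lspan_submodule (LS D) sD); apply: Ls; by exists d.
have fg d : exists G : seq {poly R}, (forall x, x \in G -> Q d x) /\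
    forall a, L d a -> exists2 x : {poly R}, lspan (V := {poly R}) (fun y => y \in G) x & x`_d = a.
  apply: (@lift_span R {poly R} (Q d) (fun p => p`_d) (L d)) => //.
    by move=> c x y; rewrite coefD coefZ.
  by rewrite coef0.
have [G [GP GL]] : exists G : seq {poly R}^o, (forall x, x \in G -> P x) /\
    forall d a, (d <= D)%N -> L d a -> exists2 x : {poly R},
      lspan (V := {poly R}^o) (fun y => y \in G) x & ((size x <= d.+1)%N /\ x`_d = a).
  elim: D {LD sD} => [|D [G [GP GL]]].
    have [G [GQ GL]] := fg 0%N; exists G; split=> [x /GQ[]//|d a].
    rewrite leqn0 => /eqP-> /GL[x xG xa]; exists x; last first.
      split=> //; have Qx : Q 0%N x by apply: (lspan_submodule (QS _) GQ).
      by case: Qx.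
    elim: xG => [|c g y gG _ IH]; first exact: lspan0.
    by rewrite -mul_polyC; apply: (@lspan_cons _ {poly R}^o).
  have [G' [GQ GL']] := fg D.+1; exists (G ++ G'); split=> [x|d a].
    by rewrite mem_cat => /orP[/GP//|/GQ[]].
  rewrite leq_eqVlt ltnS => /orP[/eqP->|dD].
    move=> /GL'[x xG xa]; exists x; last first.
      split=> //; have Qx : Q D.+1 x by apply: (lspan_submodule (QS _) GQ).
      by case: Qx.
    elim: xG => [|c g y gG _ IH]; first exact: lspan0.
    by rewrite -mul_polyC; apply: (@lspan_cons _ {poly R}^o) => //; rewrite mem_cat gG orbT.
  move=> /(GL _ _ dD)[x xG xa]; exists x => //.
  by apply: lspan_sub xG => y yG; rewrite mem_cat yG.
have span_size k : forall p : {poly R}, (size p <= k)%N -> P p ->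
    lspan (V := {poly R}^o) (fun y => y \in G) p; last first.
  by exists G; split=> // p; exact: (span_size (size (p : {poly R}))).
elim: k => [|k IH] p pk Pp.
  by rewrite (eqP (_ : p == 0)); [exact: lspan0 | rewrite -size_poly_leq0].
have Lk : L k p`_k.
  by exists p.
have [x xG [sx xp]] : exists2 x : {poly R}, lspan (V := {poly R}^o) (fun y => y \in G) x
    & ((size x <= k.+1)%N /\ x`_k = p`_k).
  (* Above degree [D] the leading coefficient is already attained in degree [D], and a power of the
     indeterminate shifts it up. *)
  case: (leqP k D) => [kD|/ltnW Dk]; first exact: GL.
  have [x xG [sx xp]] := GL D _ (leqnn _) (LD _ _ Lk).
  exists ('X^(k - D) * x); first exact: (@lspanZ _ {poly R}^o).
  split; last by rewrite coefXnM ltnNge leq_subr /= subKn.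
  rewrite (leq_trans (size_polyMleq _ _)) // size_polyXn /=.
  by rewrite (leq_trans (leq_add (leqnn _) sx)) // addnS subnK.
rewrite -(subrK x p); apply: lspanD => //.
have Px : P x by apply: lspan_submodule xG.
apply: IH; last exact: (@submoduleB _ {poly R}^o).
apply/leq_sizeP => j; rewrite leq_eqVlt => /orP[/eqP<-|kj].
  by rewrite coefB xp subrr.
by rewrite coefB !nth_default ?subrr // (leq_trans _ kj).
Qed.

Lemma noetherian_field (F : fieldType) : noetherian F^o.
Proof.
move=> P [P0 PD]; case: (classic (exists2 x, P x & x != 0)) => [[x Px x0]|no].
  exists [:: x]; split=> [y|y _]; first by rewrite inE => /eqP->.
  have -> : y = (y / x) *: (x : F^o) + 0 by rewrite addr0 /= [_ *: _]divfK.
  by apply: lspan_cons; [rewrite inE | exact: lspan0].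
exists [::]; split=> // x Px; case: (eqVneq x 0) => [->|x0]; first exact: lspan0.
by case: no; exists x.
Qed.

(** Polynomials in [k] variables as an iterated univariate ring, the form to which [hilbert_basis]
    applies [k] times; variable number [k'] is the one adjoined at stage [k'.+1]. *)
Fixpoint iter_poly (F : fieldType) (k : nat) : comNzRingType :=
  if k is k'.+1 then {poly iter_poly F k'} else F.

Fixpoint iter_ev (F : fieldType) (a : nat -> F) (k : nat) :
    {rmorphism iter_poly F k -> F} :=
  if k is k'.+1 return {rmorphism iter_poly F k -> F}
  then (horner_eval (a k') \o map_poly (iter_ev a k')) else idfun.

Lemma noetherian_iter_poly (F : fieldType) k : noetherian (iter_poly F k)^o.
Proof. by elim: k => [|k IH]; [exact: noetherian_field | exact: hilbert_basis]. Qed.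

Lemma iter_poly_var (F : fieldType) k i : (i < k)%N ->
  exists x : iter_poly F k, forall a : nat -> F, iter_ev a k x = a i.
Proof.
elim: k => // k IH; rewrite ltnS leq_eqVlt => /orP[/eqP->|/IH[x xP]].
  exists 'X => a /=; by rewrite map_polyX /horner_eval hornerX.
by exists x%:P => a /=; rewrite map_polyC /horner_eval hornerC /= xP.
Qed.

(** * Polarisation *)

Section Monomials.
Variables (F : fieldType) (n : nat).
Hypothesis F0 : [pchar F] =i pred0.
Implicit Types (t : qterm F n) (A : nat -> 'M[F]_n).

(* A slot (Some (i, j), k) is the coordinate x^(k)_ij, and (None, k) is x_k. *)
Definition slot := (option ('I_n * 'I_n) * nat)%type.

Definition qatom (o : option ('I_n * 'I_n)) (k : nat) : qterm F n :=
  if o is Some ij then QCoord k ij.1 ij.2 else QVar k.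

Definition qmon (s : seq slot) : qterm F n :=
  foldr (fun x t => QMul (qatom x.1 x.2) t) (QConst 1) s.

Definition qcomb (L : seq (F * seq slot)) : qterm F n :=
  qsum [seq QMul (QConst e.1) (qmon e.2) | e <- L].

Definition wlen (s : seq slot) := count (fun x : slot => x.1 == None) s.

Definition vatom d A (Z : nat -> 'M[F]_d) (o : option ('I_n * 'I_n)) (k : nat) : 'M[F]_d :=
  if o is Some ij then (A k ij.1 ij.2)%:M else Z k.

Lemma qev_qmon d A (Z : nat -> 'M[F]_d) s :
  qev A Z (qmon s) = \prod_(x <- s) vatom A Z x.1 x.2.
Proof.
elim: s => [|[o k] s IH] /=; first by rewrite big_nil.
by rewrite big_cons IH; case: o.
Qed.

Lemma qev_qcomb d A (Z : nat -> 'M[F]_d) L :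
  qev A Z (qcomb L) = \sum_(e <- L) e.1 *: \prod_(x <- e.2) vatom A Z x.1 x.2.
Proof.
rewrite qev_qsum big_map; apply: eq_bigr => e _ /=.
by rewrite qev_qmon mul_scalar_mx.
Qed.

Lemma qterm_qcomb t : exists L, forall d A (Z : nat -> 'M[F]_d),
  qev A Z t = qev A Z (qcomb L).
Proof.
exists [seq (e.2, [seq (Some (x.1.2, x.2), x.1.1) | x <- e.1.1] ++
                  [seq (None, k) | k <- e.1.2]) | e <- qexpand t].
move=> d A Z; rewrite qev_qexpand qev_qcomb big_map; apply: eq_bigr => e _ /=.
rewrite -scalerA big_cat !big_map /=; congr (_ *: _).
suff -> : \prod_(x <- e.1.1) (A x.1.1 x.1.2 x.2)%:M = (cval A e.1.1)%:M :> 'M[F]_d.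
  by rewrite -mul_scalar_mx.
rewrite /cval; elim: e.1.1 => [|x s IH]; first by rewrite !big_nil.
by rewrite !big_cons IH scalar_mxM.
Qed.

Section Ideal.
Variable I : qterm F n -> Prop.
Hypothesis HI : is_Tideal I.

Lemma Tideal_ev t1 t2 :
  (forall d A (Z : nat -> 'M[F]_d), qev A Z t1 = qev A Z t2) -> I t1 -> I t2.
Proof. by case: HI => Iq _ _ _ _ e; apply: Iq; apply: qev_qeq. Qed.

Lemma Tideal_mull t1 t2 : I t2 -> I (QMul t1 t2).
Proof. by case: HI => _ _ _ [IM _] _; exact: IM. Qed.

Lemma Tideal_qsum (T : eqType) (r : seq T) (f : T -> qterm F n) :
  (forall x, x \in r -> I (f x)) -> I (qsum (map f r)).
Proof.
case: HI => _ I0 ID _ _; elim: r => [//|x r IH] H /=; apply: ID.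
  by apply: H; rewrite mem_head.
by apply: IH => y yr; apply: H; rewrite inE yr orbT.
Qed.

Lemma Tideal_qsum_fin (T : finType) (f : T -> qterm F n) :
  (forall x, I (f x)) -> I (qsum [seq f x | x <- enum T]).
Proof. by move=> H; apply: Tideal_qsum. Qed.

Lemma Tideal_scale (c : F) t : c != 0 -> I (QMul (QConst c) t) -> I t.
Proof.
move=> c0 /(Tideal_mull (QConst c^-1)); apply: Tideal_ev => d A Z /=.
by rewrite mulmxA -scalar_mxM mulVf // mul1mx.
Qed.

End Ideal.

Section Linear.
Variables (m : nat) (E : finType).

Definition mval d A (Z : nat -> 'M[F]_d) (th : 'I_m -> option ('I_n * 'I_n))
    (l : 'I_m -> nat) : 'M[F]_d := \prod_(s < m) vatom A Z (th s) (l s).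

(** A combination of monomials with [m] slots. The types of the slots, [th], are kept apart from the
    letters [l] filling them, since permutations act on the letters only. *)
Definition qlin (a : E -> F) (th : E -> 'I_m -> option ('I_n * 'I_n))
    (l : E -> 'I_m -> nat) : qterm F n :=
  qcomb [seq (a e, [seq (th e s, l e s) | s <- enum 'I_m]) | e <- enum E].

Lemma qev_qlin d A (Z : nat -> 'M[F]_d) a th l :
  qev A Z (qlin a th l) = \sum_e a e *: mval A Z (th e) (l e).
Proof.
rewrite qev_qcomb big_map big_enum; apply: eq_bigr => e _ /=.
by rewrite big_map enumT /mval; congr (_ *: _); rewrite [index_enum _]unlock.
Qed.

End Linear.

(** Inclusion-exclusion: if [f] misses a value [k0], then adding or removing [k0] pairs the
    admissible sets with opposite signs; if [f] is injective, only the full set is admissible. *)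
Lemma sum_sign_supersets m (f : {ffun 'I_m -> 'I_m}) :
  \sum_(S : {set 'I_m} | [forall s, f s \in S]) (-1) ^+ #|~: S| =
  (injectiveb f)%:R :> F.
Proof.
have [/injectiveP fI|nI] := boolP (injectiveb f).
  rewrite (big_pred1 setT) => [|S]; first by rewrite setCT cards0.
  apply/forallP/eqP => [H|-> s]; last by rewrite inE.
  apply/setP => x; rewrite inE; have [g _ gK] := injF_bij fI.
  by rewrite -(gK x) H.
have [k0 k0P] : exists k0, k0 \notin codom f.
  apply/existsP; apply: contraNT nI; rewrite negb_exists => /forallP H.
  have onto x : x \in f @: setT.
    have := H x; rewrite negbK => /codomP[y ->]; exact: imset_f.
  have /imset_injP fI : #|f @: [set: 'I_m]| == #|[set: 'I_m]|.
    by apply/eqP; apply: eq_card => x; rewrite onto inE.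
  by apply/injectiveP => x y; apply: fI; rewrite inE.
pose flip (S : {set 'I_m}) := [set x | (x == k0) (+) (x \in S)].
have flipK : involutive flip.
  by move=> S; apply/setP => x; rewrite !inE addbA addbb.
have par (S : {set 'I_m}) : k0 \in S -> #|~: flip S| = #|~: S|.+1.
  move=> kS; have -> : ~: flip S = k0 |: ~: S.
    by apply/setP => x; rewrite !inE; case: eqP => [->|_] //=; rewrite kS.
  by rewrite cardsU1 inE kS.
apply: (@sum_sign_reversing F F^o _ _ flip) => //.
- by rewrite natf_neq0_char0.
- move=> S; apply: eq_forallb => s; rewrite inE.
  by have /negPf -> : f s != k0 by apply: contraNneq k0P => <-; exact: codom_f.
move=> S _; case: (boolP (k0 \in S)) => kS.
  by rewrite par // exprS mulN1r.
have kS' : k0 \in flip S by rewrite inE eqxx.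
by have := par _ kS'; rewrite flipK => ->; rewrite exprS mulN1r opprK.
Qed.

(* Substitute x_b |-> sum of the x_(eta k) over k in U with phi k = b, and take the
   alternating sum over all subsets U: only the bijective choices of k survive. *)
Lemma polarization (I : qterm F n -> Prop) m (E : finType) a
    (th : E -> 'I_m -> option ('I_n * 'I_n)) l (phi eta : 'I_m -> nat) :
  is_Tideal I -> I (qlin a th l) ->
  I (qlin (fun x : E * 'S_m => a x.1 * [forall s, phi (x.2 s) == l x.1 s]%:R)
          (fun x => th x.1) (fun x s => eta (x.2 s))).
Proof.
move=> HI If.
pose H (U : {set 'I_m}) b : qterm F n :=
  qsum [seq QVar (eta k) | k <- enum U & phi k == b].
pose T U := QMul (QConst ((-1) ^+ #|~: U|)) (qsubst (H U) (qlin a th l)).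
have IT : I (qsum [seq T U | U <- enum {set 'I_m}]).
  apply: Tideal_qsum_fin => // U; apply: Tideal_mull => //.
  by case: HI => _ _ _ _; apply.
apply: (Tideal_ev HI) IT => d A Z.
rewrite qev_qsum big_map big_enum qev_qlin.
have evH d' (W : nat -> 'M[F]_d') U b :
    qev A W (H U b) = \sum_(k in U | phi k == b) W (eta k).
  by rewrite qev_qsum big_map big_filter big_enum_cond.
pose v := vatom A Z.
have atomH U o b : vatom (fun k => qeval A (H U k)) (fun k => qev A Z (H U k)) o b
    = \sum_(k | (k \in U) && (phi k == b)) v o (eta k).
  case: o => [[i j]|] /=; last by rewrite evH.
  by rewrite qeval_qev evH summxE raddf_sum.
have evT U : qev A Z (T U) = \sum_e \sum_(f : {ffun 'I_m -> 'I_m})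
    (a e * [forall s, phi (f s) == l e s]%:R *
     ((-1) ^+ #|~: U| * [forall s, f s \in U]%:R)) *:
       \prod_(s < m) v (th e s) (eta (f s)).
  rewrite /= qev_qsubst qev_qlin mul_scalar_mx scaler_sumr; apply: eq_bigr => e _.
  rewrite /mval (eq_bigr _ (fun s _ => atomH _ _ _)).
  rewrite bigA_distr_big_dep scalerA scaler_sumr big_mkcond; apply: eq_bigr => f _ /=.
  have -> : (f \in family (fun s : 'I_m => [pred k | (k \in U) && (phi k == l e s)]))
      = [forall s, phi (f s) == l e s] && [forall s, f s \in U].
    apply/familyP/andP => [fP|[/forallP f1 /forallP f2] s]; last by rewrite inE f1 f2.
    by split; apply/forallP => s; have := fP s; rewrite inE => /andP[].
  do 2 case: [forall s, _]; rewrite /= ?mulr1 ?mulr0 ?mul0r ?scale0r //.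
  by rewrite mulrC.
rewrite (eq_bigr _ (fun U0 _ => evT U0)).
rewrite exchange_big /= -(pair_bigA _ (fun e (b : 'S_m) =>
  (a e * [forall s, phi (b s) == l e s]%:R) *: mval A Z (th e) (fun s => eta (b s)))) /=.
apply: eq_bigr => e _; rewrite exchange_big /=.
under eq_bigr => f _.
  rewrite -scaler_suml -mulr_sumr.
  under [\sum_i _ * _]eq_bigr => U0 _ do rewrite mulr_natr mulrb.
  rewrite -big_mkcond sum_sign_supersets mulr_natr mulrb.
  over.
under eq_bigr => f _ do rewrite (fun_if (fun x => x *: _)) scale0r.
rewrite -big_mkcond (reindex (fun b : 'S_m => pval b)) /=.
  apply: eq_big => [b|b _]; first exact: (valP b).
  rewrite /mval; congr (_ * _%:R *: _).
    by congr nat_of_bool; apply: eq_forallb => s; rewrite -pvalE.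
  by apply: eq_bigr => s _; rewrite -pvalE.
exists (insubd (1%g : 'S_m)) => /= f Uf; first by apply: val_inj; apply: insubdK; exact: valP.
exact: insubdK.
Qed.
End Monomials.

(** * Reduction of homogeneous quasi-identities to [r] letters *)

Section Reduction.
Variables (F : fieldType) (n : nat).
Hypothesis F0 : [pchar F] =i pred0.
Implicit Types (A : nat -> 'M[F]_n).

Lemma prod_scale_mx d m (c : 'I_m -> F) (W : 'I_m -> 'M[F]_d) :
  \prod_(s < m) (c s *: W s) = (\prod_(s < m) c s) *: \prod_(s < m) W s.
Proof.
elim: m c W => [|m IH] c W; first by rewrite !big_ord0 scale1r.
rewrite !big_ord_recl IH -[LHS]/(_ *m _) -scalemxAl -scalemxAr scalerA.
by congr (_ *: _).
Qed.

Lemma mval_split d m A (Z : nat -> 'M[F]_d) (th : 'I_m -> option ('I_n * 'I_n)) l :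
  mval A Z th l =
  (\prod_(s < m) (if th s is Some ij then A (l s) ij.1 ij.2 else 1)) *:
  \prod_(s < m) (if th s is Some ij then 1 else Z (l s)).
Proof.
rewrite -prod_scale_mx; apply: eq_bigr => s _.
by case: (th s) => [ij|] /=; rewrite ?scale1r // scalemx1.
Qed.

Lemma mval_tperm d m A (Z : nat -> 'M[F]_d) (th : 'I_m -> option ('I_n * 'I_n)) l
    (s1 s2 : 'I_m) :
  th s1 = th s2 -> th s1 != None ->
  mval A Z th (fun s => l (tperm s1 s2 s)) = mval A Z th l.
Proof.
move=> th12 th1; rewrite !mval_split; congr (_ *: _).
  rewrite (reindex_inj (@perm_inj _ (tperm s1 s2))) /=; apply: eq_bigr => s _.
  by rewrite tpermK; case: tpermP => // ->; rewrite th12.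
apply: eq_bigr => s _; case: tpermP => // ->; first by case: (th s1) th1.
by rewrite -th12; case: (th s1) th1.
Qed.

(** [Y] corresponds to [r + 1] slots, fewer than [p] of which are noncommuting. More than [n * n]
    coordinate slots remain, so two have the same position (i, j); exchanging their letters keeps
    the value and reverses the sign. *)
Lemma mval_alternating_null d m p r A (Z : nat -> 'M[F]_d)
    (th : 'I_m -> option ('I_n * 'I_n)) (phi : 'I_m -> nat) (beta : 'S_m) :
  (#|[set s | th s == None]| < p)%N -> (n * n + p <= r.+1)%N ->
  alternating_null r (fun pi : 'S_m => mval A Z th (fun s => phi (pi (beta s)))).
Proof.
move=> wp pr rho Y cY.
pose Y1 := beta @^-1: Y; pose Y2 := Y1 :\: [set s | th s == None].
have [s||s1 [s2 [s1Y s2Y s12 th12]]] := @pigeonhole_pair _ _ Y2 [set~ None] th.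
- by rewrite !inE => /andP[].
- rewrite cardsC1 card_option card_prod card_ord /=.
  have := cardsID [set s | th s == None] Y1; rewrite -/Y2.
  rewrite {2}/Y1 card_preimset; last exact: perm_inj.
  rewrite cY => e.
  have le : (#|Y1 :&: [set s | th s == None]| < p)%N.
    by apply: leq_ltn_trans wp; apply: subset_leq_card; apply: subsetIr.
  by rewrite -(ltn_add2l p) addnC (leq_ltn_trans pr) // -e -addSn leq_add2r.
move: s1Y s2Y; rewrite !inE => /andP[th1 s1Y] /andP[th2 s2Y].
apply: (@sum_sign_reversing _ _ _ _ (fun t => (tperm (beta s1) (beta s2) * t)%g)).
- by rewrite natf_neq0_char0.
- by move=> t; rewrite mulgA tperm2 mul1g.
- by move=> t; rewrite Sym_mull // tperm_Sym.
move=> t _; rewrite odd_permM odd_tperm (inj_eq perm_inj) s12 addTb signrN scaleNr.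
congr (- (_ *: _)).
rewrite -[RHS](@mval_tperm _ _ _ _ _ _ s1 s2) //; apply: eq_bigr => s _.
congr vatom; rewrite !permM; congr (phi (rho (t _))).
by rewrite -(inj_tperm s1 s2 s (@perm_inj _ beta)).
Qed.

Section Ideal.
Variable I : qterm F n -> Prop.
Hypothesis HI : is_Tideal I.
Variables p r : nat.
Hypothesis pr : (n * n + p <= r.+1)%N.
Hypothesis small : forall m (E : finType) (a : E -> F)
    (th : E -> 'I_m -> option ('I_n * 'I_n)) l,
  (forall e s, (l e s < r)%N) -> (forall e, #|[set s | th e s == None]| < p)%N ->
  quasi_identity (qlin a th l) -> I (qlin a th l).

(* Polarising f to the letters phi, then identifying letters along la, gives a
   quasi-identity in r letters, and polarising back along mu gives
   \sum_(pi | mu o pi = la) of the permuted copies of f. *)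
Lemma homogeneous_reduction m (E : finType) (a : E -> F)
    (th : E -> 'I_m -> option ('I_n * 'I_n)) l :
  (forall e, #|[set s | th e s == None]| < p)%N ->
  quasi_identity (qlin a th l) -> I (qlin a th l).
Proof.
move=> wp qf.
have [q lq] : exists q, forall e s, (l e s < q)%N.
  exists (\max_e \max_s l e s).+1 => e s; rewrite ltnS.
  exact: leq_trans (leq_bigmax s) (leq_bigmax (F := fun e => \max_s l e s) e).
have [d [za [zc [d0 span]]]] := perm_span m r.
pose h (phi : {ffun 'I_m -> 'I_q}) (la : {ffun 'I_m -> 'I_r}) :=
  qlin (fun x : E * 'S_m => a x.1 * [forall s, phi (x.2 s) == l x.1 s :> nat]%:R)
       (fun x => th x.1) (fun x s => la (x.2 s)).
pose k (phi : {ffun 'I_m -> 'I_q}) (mu la : {ffun 'I_m -> 'I_r}) :=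
  qlin (fun x : E * 'S_m * 'S_m =>
          a x.1.1 * [forall s, phi (x.1.2 s) == l x.1.1 s :> nat]%:R *
          [forall s, mu (x.2 s) == la (x.1.2 s) :> nat]%:R)
       (fun x => th x.1.1) (fun x s => phi (x.2 s)).
have Ik phi mu la : I (k phi mu la).
  have Ih : I (h phi la).
    apply: small => [e s|e|]; rewrite ?ltn_ord //.
    (* Polarising within the T-ideal of quasi-identities shows that [h] is a quasi-identity; its
       letters are colours below [r], so [small] applies. *)
    exact: (@polarization _ _ F0 _ m _ _ _ _ (fun s => phi s : nat) (fun s => la s : nat) (quasi_identity_Tideal F n) qf).
  exact: (@polarization _ _ F0 _ m _ _ _ _ (fun s => mu s : nat) (fun s => phi s : nat) HI Ih).
pose G := qsum [seq qsum [seq qsum [seq QMul (QConst (zc mu la)%:~R) (k phi mu la)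
  | la <- enum {ffun 'I_m -> 'I_r}] | mu <- enum {ffun 'I_m -> 'I_r}]
  | phi <- enum {ffun 'I_m -> 'I_q}].
have IG : I G.
  by do 3 (apply: (Tideal_qsum_fin HI) => ?); apply: (Tideal_mull HI).
(* For given [e] and [b] exactly one [phi] satisfies [phi (b s) = l e s] for all [s], so the sum
   over all [phi] produces each summand m! times. The factor [d] comes from [perm_span]. *)
apply: (@Tideal_scale _ _ F0 _ HI ((m`!)%:R * d%:~R)).
  rewrite mulf_neq0 // ?natf_neq0_char0 // -?lt0n ?fact_gt0 //.
  case: (d) d0 => j j0; first by rewrite natf_neq0_char0.
  by rewrite NegzE rmorphN oppr_eq0 natf_neq0_char0.
apply: (Tideal_ev F0 HI) IG => e0 A Z.
rewrite /= qev_qlin mul_scalar_mx.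
have inner phi :
  \sum_mu \sum_la (zc mu la)%:~R *: qev A Z (k phi mu la) =
  \sum_e \sum_(b : 'S_m) (a e * [forall s, phi (b s) == l e s :> nat]%:R * d%:~R)
     *: mval A Z (th e) (l e).
  have evk mu la : qev A Z (k phi mu la) =
      \sum_e \sum_(b : 'S_m) (a e * [forall s, phi (b s) == l e s :> nat]%:R) *:
        \sum_(pi | carries mu la pi) mval A Z (th e) (fun s => phi (pi (b s))).
    rewrite qev_qlin pair_bigA -(pair_bigA _ (fun (x : E * 'S_m) (g : 'S_m) => (a x.1 * 
      [forall s, phi (x.2 s) == l x.1 s :> nat]%:R *
      [forall s, mu (g s) == la (x.2 s) :> nat]%:R) *: mval A Z (th x.1) (fun s => phi (g s)))) /=.
    apply: eq_bigr => -[e b] _ /=.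
    rewrite scaler_sumr (reindex_inj (mulgI b)) [RHS]big_mkcond.
    apply: eq_bigr => pi _ /=.
    have -> : [forall s, mu ((b * pi)%g s) == la (b s) :> nat] = carries mu la pi.
      apply/forallP/forallP => H s; last by rewrite permM (eqP (H _)).
      by have := H ((b^-1)%g s); rewrite permM permKV.
    case: carries; rewrite ?mulr1 ?mulr0 ?scale0r //; congr (_ *: _).
    by apply: eq_bigr => s _; rewrite permM.
  under eq_bigr => mu _ do under eq_bigr => la _ do rewrite evk scaler_sumr.
  under eq_bigr => mu _ do rewrite exchange_big /=.
  rewrite exchange_big /=; apply: eq_bigr => e _.
  under eq_bigr => mu _ do under eq_bigr => la _ do rewrite scaler_sumr.
  under eq_bigr => mu _ do rewrite exchange_big /=.
  rewrite exchange_big /=; apply: eq_bigr => b _.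
  have := perm_span_null span (@mval_alternating_null _ _ _ _ A Z (th e) (fun s => phi s : nat) b (wp e) pr).
  rewrite /= => E1.
  transitivity ((a e * [forall s, phi (b s) == l e s :> nat]%:R) *:
     (d%:~R *: mval A Z (th e) (fun s => phi (perm_one _ (b s))))); last first.
    case: forallP => [H|_]; last by rewrite mulr0 mul0r !scale0r.
    rewrite scalerA; congr (_ *: _); apply: eq_bigr => s _.
    by rewrite perm1 (eqP (H s)).
  rewrite [X in _ = _ *: X]E1 scaler_sumr; apply: eq_bigr => mu _.
  rewrite scaler_sumr; apply: eq_bigr => la _.
  by rewrite !scalerA mulrC.
rewrite qev_qsum big_map big_enum.
transitivity (\sum_phi \sum_e \sum_(b : 'S_m) (a e *
    [forall s, (phi : {ffun 'I_m -> 'I_q}) (b s) == l e s :> nat]%:R * d%:~R)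
     *: mval A Z (th e) (l e)).
  apply: eq_bigr => phi _; rewrite -inner qev_qsum big_map big_enum.
  apply: eq_bigr => mu _; rewrite qev_qsum big_map big_enum.
  by apply: eq_bigr => la _; rewrite /= mul_scalar_mx.
rewrite exchange_big scaler_sumr; apply: eq_bigr => e _; rewrite exchange_big /=.
rewrite (eq_bigr (fun=> (a e * d%:~R) *: mval A Z (th e) (l e))); last first.
  move=> b _; pose phi0 := [ffun j : 'I_m => Ordinal (lq e ((b^-1)%g j))].
  rewrite (bigD1 phi0) //= big1 ?addr0.
    case: forallP => [_|[]]; first by rewrite mulr1.
    by move=> s; rewrite ffunE /= permK.
  move=> phi np; case: forallP => [H|_]; last by rewrite mulr0 mul0r scale0r.
  case/eqP: np; apply/ffunP => j; rewrite ffunE; apply: val_inj => /=.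
  by rewrite -(eqP (H _)) permKV.
rewrite sumr_const card_Sn -scaler_nat !scalerA; congr (_ *: _).
by rewrite mulrA mulrAC mulrC mulrA.
Qed.

End Ideal.
End Reduction.

(** * Reduction to short words *)

Section TracePerm.
Variables (F : fieldType) (n : nat) (T : finType).
Local Notation idx := {ffun T -> 'I_n}.
Implicit Types (s : {perm T}) (X : T -> 'M[F]_n) (i j : {ffun T -> 'I_n}).

(* The product of traces, one for each cycle (k, s k, ...) of s, of the
   matrices X k * X (s k) * ... . *)
Definition trace_perm X s : F := \sum_(i : idx) \prod_k X k (i k) (i (s k)).

Lemma sum_fix_value (h : {ffun T -> 'I_n} -> F) (y : T) (a : 'I_n) :
  (forall i j, (forall k, k != y -> i k = j k) -> h i = h j) ->
  n%:R * (\sum_(i : idx) (i y == a)%:R * h i) = \sum_(i : idx) h i.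
Proof.
move=> hy.
have same a' : \sum_(i : {ffun T -> 'I_n} | i y == a') h i =
               \sum_(i : {ffun T -> 'I_n} | i y == a) h i.
  pose sw i := [ffun k => if k == y then tperm a a' (i k) else i k].
  have swK : involutive sw.
    by move=> i; apply/ffunP => k; rewrite !ffunE; case: eqP => // _; rewrite tpermK.
  rewrite (reindex_inj (inv_inj swK)); apply: eq_big => [i|i _].
    by rewrite ffunE eqxx (can2_eq (@tpermK _ a a') (@tpermK _ a a')) tpermR.
  by apply: hy => k /negPf ky; rewrite ffunE ky.
rewrite [RHS](partition_big (fun i : {ffun T -> 'I_n} => i y) xpredT) //=.
rewrite (eq_bigr _ (fun a' _ => same a')) sumr_const card_ord -[RHS]mulr_natl.
by congr (_ * _); rewrite [RHS]big_mkcond; apply: eq_bigr => i _; case: eqP => _;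
  rewrite ?mul1r ?mul0r.
Qed.

(** Summing over the indices along a path multiplies matrices. The sum runs over all of [idx], so
    every index off the path contributes a factor [n]; powers of [n] on both sides avoid subtraction
    in the exponent. *)
Lemma sum_path (A : T -> 'M[F]_n) s (y : T) (p : seq T) (a b : 'I_n) :
  uniq (y :: p) -> fpath s y p ->
  n%:R ^+ (size p).+1 * (\sum_(i : idx) (i y == a)%:R * ((i (last y p) == b)%:R *
     \prod_(k <- belast y p) A k (i k) (i (s k)))) =
  n%:R ^+ #|T| * (\prod_(k <- belast y p) A k) a b.
Proof.
elim: p y a => [|z p IH] y a.
  move=> _ _ /=; rewrite expr1 !big_nil.
  under eq_bigr => i _ do rewrite big_nil mulr1.
  transitivity (n%:R * \sum_(i : idx) (i y == a)%:R * (a == b)%:R : F).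
    congr (_ * _); apply: eq_bigr => i _; case: eqP => [->|]; by rewrite ?mul0r.
  rewrite sum_fix_value // sumr_const card_ffun card_ord mxE -[LHS]mulr_natl natrX.
  by [].
move=> /= /andP[yp up] /andP[/eqP syz fp]; rewrite big_cons -[A y * _]/(A y *m _).
have step a' : n%:R ^+ (size p).+2 * (\sum_(i : idx) (i y == a)%:R * ((i z == a')%:R *
     ((i (last z p) == b)%:R * \prod_(k <- belast z p) A k (i k) (i (s k))))) =
    n%:R ^+ #|T| * (\prod_(k <- belast z p) A k) a' b.
  rewrite -(IH z a') // [in LHS]exprSr -mulrA sum_fix_value // => i j ij.
  have ne k : k \in z :: p -> k != y by move=> kp; apply: contraNneq yp => <-.
  rewrite !ij ?ne ?mem_head ?mem_last //; congr (_ * (_ * _)).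
  rewrite big_seq [RHS]big_seq; apply: eq_bigr => k kb.
  have kp : k \in z :: p by rewrite (mem_belast kb).
  have skp : s k \in z :: p.
    elim: p z fp kb {IH yp up syz ne kp} => // w p IH z /= /andP[/eqP zw fp].
    rewrite inE => /orP[/eqP->|kb]; first by rewrite zw !inE eqxx orbT.
    by rewrite inE IH ?orbT.
  by rewrite !ij ?ne.
rewrite mxE mulr_sumr.
under [RHS]eq_bigr => a' _ do rewrite mulrCA -step mulrCA.
rewrite -mulr_sumr; congr (_ * _).
under [RHS]eq_bigr => a' _ do rewrite mulr_sumr.
rewrite exchange_big; apply: eq_bigr => i _ /=.
rewrite (bigD1 (i z)) //= [X in _ + X]big1 ?addr0 => [|a' /negPf na].
  rewrite big_cons syz eqxx mul1r; case: eqP => [->|_]; last by rewrite !mul0r mulr0.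
  by rewrite !mul1r mulrCA.
by rewrite [i z == _]eq_sym na mul0r !mulr0.
Qed.

(** In the double sum over (i, j), exchange the values of [i] and [j] outside [D]: the summand
    becomes [f i * g i], and [j] is free. *)
Lemma sum_independent (D : {set T}) (f g : {ffun T -> 'I_n} -> F) :
  (forall i j, {in D, i =1 j} -> f i = f j) ->
  (forall i j, {in ~: D, i =1 j} -> g i = g j) ->
  (\sum_(i : idx) f i) * (\sum_(i : idx) g i) = n%:R ^+ #|T| * \sum_(i : idx) f i * g i.
Proof.
move=> fD gD; rewrite mulr_suml; under eq_bigr => i _ do rewrite mulr_sumr.
pose mix i j := [ffun k => if k \in D then i k else j k].
rewrite pair_bigA /= (reindex_inj (inv_inj (_ : involutive (fun x => (mix x.1 x.2, mix x.2 x.1))))) /=; last first.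
  by move=> [i j] /=; congr (_, _); apply/ffunP => k; rewrite !ffunE; case: (k \in D).
rewrite (eq_bigr (fun x => f x.1 * g x.1)).
  rewrite -(pair_bigA _ (fun i j => f i * g i)) /= mulr_sumr; apply: eq_bigr => i _.
  by rewrite sumr_const card_ffun card_ord -natrX mulr_natl.
move=> [i j] _ /=; congr (_ * _).
  by apply: fD => k kD; rewrite ffunE kD.
by apply: gD => k; rewrite inE => /negPf kD; rewrite ffunE kD.
Qed.

(** [x] itself is left out, because its place will be taken by the matrix unit that cuts the cycle
    open. *)
Definition cycle_word s (x : T) := traject s (s x) #|porbit s x|.-1.

Lemma cycle_wordE s x : traject s (s x) #|porbit s x| = rcons (cycle_word s x) x.
Proof.
rewrite /cycle_word; case e: #|porbit s x| => [|l].
  by have := porbit_id s x; rewrite (card0_eq e).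
rewrite trajectSr -iterSr.
by have := iter_porbit s x; rewrite e => /= ->.
Qed.

Lemma cycle_word_uniq s x : uniq (rcons (cycle_word s x) x).
Proof.
rewrite -cycle_wordE; have -> : #|porbit s x| = #|porbit s (s x)|.
  by rewrite (porbit_perm s 1 x).
exact: uniq_traject_porbit.
Qed.

Lemma mem_cycle_word s x : rcons (cycle_word s x) x =i porbit s x.
Proof.
move=> k; rewrite -cycle_wordE; have e : porbit s x = porbit s (s x).
  by rewrite (porbit_perm s 1 x).
by rewrite e -porbit_traject.
Qed.

(** A matrix unit at [x] forces the indices at [x] and [s x] to be [b] and [a], so the trace of this
    cycle becomes the (a, b) entry of a word; the other cycles remain as a scalar. The power of [n]
    compensates for the indices on the orbit, which are free in the sum on the right. *)
Lemma trace_perm_word (n0 : n%:R != 0 :> F) (A : T -> 'M[F]_n) s x (a b : 'I_n) :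
  n%:R ^+ #|porbit s x| *
    trace_perm (fun k => if k == x then delta_mx b a else A k) s =
  (\sum_(i : idx) \prod_(k in ~: porbit s x) A k (i k) (i (s k))) *
  (\prod_(k <- cycle_word s x) A k) a b.
Proof.
set X := fun k => _; pose O := porbit s x.
have sO k : (s k \in O) = (k \in O).
  by rewrite /O porbit_sym (porbit_perm s 1 k) porbit_sym.
pose f i := \prod_(k in O) X k (i k) (i (s k)).
pose g i := \prod_(k in ~: O) A k (i k) (i (s k)).
have fg : trace_perm X s = \sum_(i : idx) f i * g i.
  apply: eq_bigr => i _; rewrite (bigID (mem O)) /=; congr (_ * _).
  apply: eq_big => [k|k kO]; first by rewrite inE.
  rewrite /X; case: eqP kO => // ->.
  by rewrite /O porbit_id.
have ef : n%:R ^+ #|O| * \sum_(i : idx) f i = n%:R ^+ #|T| * (\prod_(k <- cycle_word s x) A k) a b.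
  have := cycle_wordE s x; have := cycle_word_uniq s x.
  have := mem_cycle_word s x; rewrite -/O.
  case E: #|O| => [|l]; first by have := porbit_id s x; rewrite -/O (card0_eq E).
  rewrite /= => memO uO tE.
  have eb : belast (s x) (traject s (s (s x)) l) = cycle_word s x.
    have := lastI (s x) (traject s (s (s x)) l); rewrite tE.
    by move/rcons_inj => [-> _].
  have el : last (s x) (traject s (s (s x)) l) = x.
    have := lastI (s x) (traject s (s (s x)) l); rewrite tE.
    by move/rcons_inj => [_ <-].
  have := @sum_path A s (s x) (traject s (s (s x)) l) a b.
  rewrite tE uO fpath_traject size_traject eb el => <- //; congr (_ * _).
  apply: eq_bigr => i _; rewrite /f.
  have -> : \prod_(k in O) X k (i k) (i (s k)) =
      \prod_(k <- rcons (cycle_word s x) x) X k (i k) (i (s k)).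
    by rewrite -(eq_bigl _ _ memO) -big_uniq.
  rewrite -cats1 big_cat big_seq1 /= /X eqxx mxE.
  rewrite mulrC -mulnb natrM mulrA [(_ == b)%:R * _]mulrC -!mulrA; congr (_ * (_ * _)).
  rewrite big_seq [RHS]big_seq; apply: eq_bigr => k kw.
  case: eqP => // ekx; have := cycle_word_uniq s x.
  by rewrite rcons_uniq -{1}ekx kw.
have nT : n%:R ^+ #|T| != 0 :> F by rewrite expf_neq0.
apply: (mulfI nT); rewrite mulrCA fg -(@sum_independent O).
- by rewrite mulrA ef -mulrA [X in _ = _ * X]mulrC.
- move=> i j ij; apply: eq_bigr => k kO; by rewrite !ij ?sO.
move=> i j ij; apply: eq_bigr => k kO; rewrite !ij //.
by rewrite inE sO -in_setC.
Qed.

End TracePerm.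

(** The fundamental trace identity: among [n + 1] places two have the same row index, since an index
    takes only [n] values, and exchanging them reverses the sign. *)
Lemma trace_perm_alternating (F : fieldType) n m (X : 'I_m -> 'M[F]_n) (c : 'S_m) :
  (2%:R : F) != 0 ->
  alternating_null n (fun s => trace_perm X (s * c)%g : F^o).
Proof.
move=> n2 rho Y cY.
under eq_bigr => t _ do rewrite /trace_perm scaler_sumr.
rewrite exchange_big big1 // => i _ /=.
have [//||a [b [aY bY ab /= fab]]] :=
  @pigeonhole_pair _ _ Y setT (fun k => i ((rho * c)%g k)).
  by rewrite cardsT card_ord cY.
apply: (@sum_sign_reversing _ _ _ _ (fun t => (t * tperm a b)%g)) => //.
- by move=> t; rewrite -mulgA tperm2 mulg1.
- by move=> t; rewrite Sym_mulr // tperm_Sym.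
move=> t _; rewrite odd_permM odd_tperm ab addbT signrN scaleNr.
congr (- (_ *: _)); apply: eq_bigr => k _; congr (X k _ _).
by move: fab; rewrite !permM; case: tpermP => // ->.
Qed.

(** Origin of m = n^2 + 1: with [n] colours this is the least m forcing [n + 1] places of one
    colour. *)
Lemma large_colour_class m r (la : {ffun 'I_m -> 'I_r}) : (r * r < m)%N ->
  exists2 Y : {set 'I_m}, #|Y| = r.+1 & {in Y &, forall k l, la k = la l}.
Proof.
move=> rm; have [c cP] : exists c, (r < #|[set k | la k == c]|)%N.
  apply/existsP; apply: contraTT rm; rewrite negb_exists -leqNgt => /forallP H.
  have e : (\sum_(k < m) 1 = \sum_(c < r) \sum_(k < m | la k == c) 1)%N.
    exact: partition_big.
  rewrite -{1}(card_ord m) -sum1_card e.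
  rewrite -[X in (_ <= X * _)%N](card_ord r) -sum_nat_const leq_sum // => c _.
  by rewrite sum1dep_card leqNgt H.
exists [set k in take r.+1 (enum [set k | la k == c])].
  rewrite cardsE (card_uniqP _) ?take_uniq ?enum_uniq //.
  by rewrite size_takel // -cardE.
have cl k : k \in [set k in take r.+1 (enum [set k | la k == c])] -> la k = c.
  by rewrite inE => /mem_take; rewrite mem_enum inE => /eqP.
by move=> k l /cl-> /cl->.
Qed.

(** Multiplying by an element of [Sym Y], with [la] constant on [Y], preserves the set of carried
    permutations. Averaging over [Sym Y] thus leaves the sum unchanged, while it creates alternating
    sums of [psi], which vanish. *)
Lemma sum_sign_carries_null (F : fieldType) (F0 : [pchar F] =i pred0)
    (V : lmodType F) m r (mu la : {ffun 'I_m -> 'I_r}) (psi : 'S_m -> V) :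
  (r * r < m)%N -> alternating_null r psi ->
  \sum_(s | carries mu la s) (-1) ^+ s *: psi s = 0.
Proof.
move=> rm null; have [Y cY laY] := large_colour_class la rm.
set S := LHS.
have shift t : t \in Sym Y ->
    S = \sum_(s | carries mu la s) (-1) ^+ s *: ((-1) ^+ t *: psi (t * s)%g).
  move=> tY; rewrite /S (reindex_inj (mulgI t)) /=; apply: eq_big => [s|s _].
    have lat k : la (t k) = la k.
      case: (boolP (k \in Y)) => kY.
        by apply: laY => //; move: tY; rewrite inE => /perm_closed->.
      by move: tY; rewrite inE => tY; rewrite (out_perm tY kY).
    apply/forallP/forallP => H k.
      by have := H ((t^-1)%g k); rewrite permM permKV -lat permKV.
    by have := H (t k); rewrite permM lat.
  by rewrite scalerA -signr_addb odd_permM addbC.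
have : \sum_(t in Sym Y) S = 0.
  rewrite (eq_bigr _ shift) exchange_big big1 // => s _ /=.
  by rewrite -scaler_sumr (null s Y cY) scaler0.
rewrite sumr_const -scaler_nat => /eqP; rewrite scaler_eq0 => /orP[|/eqP//].
rewrite (negPf (_ : _ != 0)) // natf_neq0_char0 // -lt0n card_gt0.
by apply/set0Pn; exists 1%g; exact: (group1 (Sym_group _)).
Qed.

Lemma prod_scalar_mx (F : fieldType) d (T : Type) (r : seq T) (f : T -> F) :
  \prod_(k <- r) (f k)%:M = (\prod_(k <- r) f k)%:M :> 'M[F]_d.
Proof.
elim: r => [|k r IH]; first by rewrite !big_nil.
by rewrite !big_cons IH scalar_mxM.
Qed.

Section Razmyslov.
Variables (F : fieldType) (n : nat).
Hypotheses (F0 : [pchar F] =i pred0) (n_gt0 : (0 < n)%N).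
Let N := (n * n)%N.
Let x : 'I_N.+1 := ord_max.

(** Opened at its last point [x = N], the cycle k -> k + 1 modulo N + 1 reads 0, 1, ..., N - 1, the
    word to be reduced. *)
Definition shift_cycle : 'S_N.+1 := perm (@ordS_inj N.+1).
Let c := shift_cycle.

Lemma iter_shift_cycle i : (i < N.+1)%N -> iter i.+1 c x = i :> nat.
Proof.
elim: i => [_|i IH iN]; first by rewrite /= permE /= modnn.
by rewrite iterS permE /= IH ?modn_small // ltnW.
Qed.

Lemma porbit_shift_cycle : #|porbit c x| = N.+1.
Proof.
rewrite -[RHS](card_ord N.+1); apply: eq_card => k; rewrite [RHS]inE.
have -> : k = (c ^+ k.+1)%g x.
  by apply: ord_inj; rewrite permX iter_shift_cycle.
exact: mem_porbit.
Qed.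

Lemma cycle_word_shift : map val (cycle_word c x) = iota 0 N.
Proof.
rewrite /cycle_word porbit_shift_cycle /=.
apply: (@eq_from_nth _ 0%N) => [|i]; rewrite size_map size_traject ?size_iota //.
move=> iN; rewrite (nth_map (c x)) ?size_traject // nth_iota // nth_traject //.
by rewrite -iterSr iter_shift_cycle // ltnS ltnW.
Qed.

Lemma odd_perm_full (s : 'S_N.+1) : #|porbit s x| = N.+1 ->
  s = odd N.+1 (+) true :> bool.
Proof.
move=> full; rewrite /odd_perm card_ord; congr (_ (+) _).
have pT : porbit s x = setT.
  by apply/eqP; rewrite eqEcard subsetT cardsT card_ord full /=.
suff -> : porbits s = [set setT] by rewrite cards1.
apply/setP => Y; rewrite inE; apply/imsetP/eqP => [[y _ ->]|->]; last first.
  by exists x.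
have : y \in porbit s x by rewrite pT inE.
by rewrite -eq_porbit_mem => /eqP ->.
Qed.

(* All full cycles have the same sign.  Hence multiplying by the sign the
   symmetric part v of the decomposition d * [s = 1] = u + v does not change the
   coefficients of the full cycles, but makes it alternating, and alternating
   combinations of the trace monomials vanish on n x n matrices.  The other
   permutations give shorter words with coefficients. *)
Theorem razmyslov_reduction : exists LR : seq (F * seq (slot n)),
  (forall e, e \in LR -> (wlen e.2 < N)%N /\ forall y, y \in e.2 -> (y.2 < N)%N) /\
  forall A : nat -> 'M[F]_n, \prod_(k <- iota 0 N) A k =
    \sum_(e <- LR) e.1 *: \prod_(y <- e.2) vatom A A y.1 y.2.
Proof.
have [d [za [zc [d0 span]]]] := perm_span N.+1 n.
have dF : d%:~R != 0 :> F.
  case: (d) d0 => j j0; first by rewrite natf_neq0_char0.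
  by rewrite NegzE rmorphN oppr_eq0 natf_neq0_char0.
have nF : n%:R != 0 :> F by rewrite natf_neq0_char0 // -lt0n.
pose u s := \sum_rho \sum_(Y : {set 'I_N.+1} | #|Y| == n.+1) za rho Y * alt_coset rho Y s.
pose v s := \sum_mu \sum_la zc mu la * (carries mu la s)%:R.
pose z (s : 'S_N.+1) : F := (u s)%:~R + (-1) ^+ s * (v s)%:~R.
pose full (s : 'S_N.+1) := #|porbit (s * c)%g x| == N.+1.
have znull (X : 'I_N.+1 -> 'M[F]_n) : \sum_s z s * trace_perm X (s * c)%g = 0.
  have n2 : (2%:R : F) != 0 by rewrite natf_neq0_char0.
  have null := trace_perm_alternating X c n2.
  under eq_bigr => s _ do rewrite /z mulrDl.
  have unull : \sum_s (u s)%:~R * trace_perm X (s * c)%g = 0.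
    exact: (sum_alt_coset_null za null).
  rewrite big_split /= unull add0r.
  have vsum (t : 'S_N.+1 -> F) : \sum_(s : 'S_N.+1) (-1) ^+ s * (v s)%:~R * t s =
     \sum_mu \sum_la ((zc mu la)%:~R : F) *
       \sum_(s | carries mu la s) (-1) ^+ s * t s.
    under eq_bigr => s _ do rewrite /v rmorph_sum /= mulr_sumr mulr_suml.
    rewrite exchange_big; apply: eq_bigr => mu _ /=.
    under eq_bigr => s _ do rewrite rmorph_sum /= mulr_sumr mulr_suml.
    rewrite exchange_big; apply: eq_bigr => la _ /=.
    rewrite [in RHS]big_mkcond mulr_sumr; apply: eq_bigr => s _.
    rewrite intrM; case: carries; last by rewrite !mulr0 mul0r.
    by rewrite mulr1 mulrA [_ * (-1) ^+ _]mulrC.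
  rewrite vsum.
  rewrite big1 // => mu _; rewrite big1 // => la _.
  have := sum_sign_carries_null F0 mu la (ltnSn _ : (n * n < N.+1)%N) null.
  by move=> H; rewrite [X in _ * X]H mulr0.
(* [s * c] and [c] are both full cycles and have the same sign, so [s] is even and [z s] equals
   [u s + v s]. *)
have zfull s : full s -> z s = d%:~R * (s == 1%g)%:R.
  move=> /eqP /odd_perm_full; rewrite odd_permM.
  have := odd_perm_full porbit_shift_cycle => -> /(canRL (addbK _)).
  rewrite addbb => s0; rewrite /z s0 expr0 mul1r -rmorphD /= span rmorphM /=.
  by rewrite rmorph_nat.
pose mons s (i : {ffun 'I_N.+1 -> 'I_n}) : seq (slot n) :=
  [seq (Some (i k, i ((s * c)%g k)), nat_of_ord k) | k <- enum (~: porbit (s * c)%g x)] ++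
  [seq (None, nat_of_ord k) | k <- cycle_word (s * c)%g x].
pose co s := - (z s / (d%:~R * n%:R ^+ #|porbit (s * c)%g x|)).
exists [seq (co s, mons s i) | s <- enum [pred s | ~~ full s],
                             i <- enum {ffun 'I_N.+1 -> 'I_n}]; split.
  move=> _ /allpairsP[[s i] [/= sf _ ->]] /=.
  move: sf; rewrite mem_enum inE => sf; split.
    rewrite /wlen count_cat !count_map (eq_count (a2 := pred0)) // count_pred0 add0n.
    rewrite (eq_count (a2 := predT)) // count_predT size_traject.
    have le : (#|porbit (s * c)%g x| <= N.+1)%N by rewrite -[X in (_ <= X)%N](card_ord N.+1) max_card.
    case e: #|_| le sf => [|l]; first by have := porbit_id (s * c)%g x; rewrite (card0_eq e).
    by rewrite /full e eqSS ltnS leq_eqVlt => /orP[->|].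
  (* The point [x = N] lies on the orbit that was cut open and is absent from its word, so only
     letters below [N] occur. *)
  have ltx (k : 'I_N.+1) : k != x -> (k < N)%N.
    by move=> kx; rewrite ltn_neqAle -ltnS ltn_ord andbT; apply: contraNneq kx => e; apply/eqP/ord_inj.
  move=> y; rewrite mem_cat => /orP[] /mapP[k kP ->] /=; apply: ltx.
    move: kP; rewrite mem_enum inE; apply: contraNneq => ->; exact: porbit_id.
  have := cycle_word_uniq (s * c)%g x; rewrite rcons_uniq => /andP[xw _].
  by apply/eqP => kx; rewrite -{1}kx kP in xw.
move=> A; apply/matrixP => a b; rewrite summxE big_allpairs_dep /=.
pose A' (k : 'I_N.+1) := A k.
(* With the matrix unit at [x], the vanishing trace expression [znull] becomes the (a, b) entry of
   the reduction. *)
pose X (k : 'I_N.+1) := if k == x then delta_mx b a else A' k.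
pose W s := (\prod_(k <- cycle_word s x) A' k) a b.
pose C s := \sum_(i : {ffun 'I_N.+1 -> 'I_n}) \prod_(k in ~: porbit s x) A' k (i k) (i (s k)).
have tr s : n%:R ^+ #|porbit s x| * trace_perm X s = C s * W s.
  exact: trace_perm_word.
have nX l : n%:R ^+ l != 0 :> F by rewrite expf_neq0.
have Wc : W c = (\prod_(k <- iota 0 N) A k) a b.
  by rewrite /W -cycle_word_shift big_map.
have trc : trace_perm X c = W c.
  apply: (mulfI (nX #|porbit c x|)); rewrite tr; congr (_ * _).
  rewrite porbit_shift_cycle /C (eq_bigr (fun=> 1)).
    by rewrite sumr_const card_ffun !card_ord natrX.
  move=> i _; rewrite big1 // => k; rewrite inE => /negP[].
  have -> : porbit c x = setT.
    by apply/eqP; rewrite eqEcard subsetT cardsT card_ord porbit_shift_cycle /=.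
  by rewrite inE.
have term s : \sum_(i <- enum {ffun 'I_N.+1 -> 'I_n})
    (co s *: \prod_(y <- mons s i) vatom A A y.1 y.2) a b =
    - (z s / d%:~R * trace_perm X (s * c)%g).
  transitivity (co s * (C (s * c)%g * W (s * c)%g)).
    rewrite big_enum mulr_suml mulr_sumr; apply: eq_bigr => i _ /=.
    rewrite mxE; congr (_ * _); rewrite big_cat !big_map /= prod_scalar_mx.
    by rewrite -[_ * _]/(_ *m _) mul_scalar_mx mxE big_enum.
  rewrite -tr /co mulNr; congr (- _).
  rewrite invfM -!mulrA; congr (_ * (_ * _)).
  by rewrite mulrA mulVf ?mul1r.
rewrite (eq_bigr _ (fun s _ => term s)) big_enum sumrN -Wc -trc.
apply: (mulfI dF); rewrite mulrN [X in _ = - X]mulr_sumr; apply/eqP; rewrite -addr_eq0; apply/eqP.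
rewrite -[RHS](znull X) [RHS](bigID full) /=; congr (_ + _).
  rewrite (bigD1 1%g) /=; last by rewrite /full mul1g porbit_shift_cycle.
  rewrite zfull ?/full ?mul1g ?porbit_shift_cycle // eqxx mulr1 [X in _ = _ + X]big1 ?addr0 //.
  by move=> s /andP[sf /negPf s1]; rewrite zfull // s1 mulr0 mul0r.
apply: eq_big => [s|s _]; first by rewrite inE.
by rewrite mulrA [_ * (_ / _)]mulrC divfK.
Qed.
End Razmyslov.

(** * Rewriting to short words, and homogeneous components *)

Section Assembly.
Variables (F : fieldType) (n : nat).
Hypothesis F0 : [pchar F] =i pred0.
Implicit Types (t : qterm F n) (A : nat -> 'M[F]_n) (s : seq (slot n)).

Definition qsub t1 t2 := QAdd t1 (QMul (QConst (-1)) t2).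

Lemma qev_qsub d A (Z : nat -> 'M[F]_d) t1 t2 :
  qev A Z (qsub t1 t2) = qev A Z t1 - qev A Z t2.
Proof. by rewrite /= mul_scalar_mx scaleN1r. Qed.

Lemma vatom_coords_scalar d A (Z : nat -> 'M[F]_d) s :
  \prod_(x <- s | x.1 != None) vatom A Z x.1 x.2 =
  (\prod_(x <- s) (if x.1 is Some ij then A x.2 ij.1 ij.2 else 1))%:M.
Proof.
elim: s => [|[[ij|] k] s IH]; rewrite ?big_nil // !big_cons IH /=.
  by rewrite scalar_mxM.
by rewrite mul1r.
Qed.

Lemma mon_split d A (Z : nat -> 'M[F]_d) s :
  \prod_(x <- s) vatom A Z x.1 x.2 =
  \prod_(x <- s | x.1 != None) vatom A Z x.1 x.2 *
  \prod_(x <- s | x.1 == None) Z x.2.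
Proof.
elim: s => [|[[ij|] k] s IH]; rewrite ?big_nil ?mulr1 // !big_cons IH /=.
  by rewrite mulrA.
by rewrite vatom_coords_scalar !mulrA; congr (_ * _); exact: scalar_mxC.
Qed.

Definition bounded (p : nat) (L : seq (F * seq (slot n))) :=
  forall e, e \in L -> (wlen e.2 < p)%N.

Section Bounded.
Variable I : qterm F n -> Prop.
Hypothesis HI : is_Tideal I.
Variables (p : nat) (LR : seq (F * seq (slot n))).
Hypothesis LRp : bounded p LR.
Hypothesis IR : I (qsub (qmon F [seq (None, k) | k <- iota 0 p]) (qcomb LR)).

Lemma bounded_qcomb L :
  (forall e, e \in L -> exists2 L1, bounded p L1 & I (qsub (qmon F e.2) (qcomb L1))) ->
  exists2 L1, bounded p L1 & I (qsub (qcomb L) (qcomb L1)).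
Proof.
have [_ I0 ID _ _] := HI.
elim: L => [|e L IH] H.
  exists [::] => //; apply: (Tideal_ev F0 HI) I0 => d A Z.
  by rewrite qev_qsub subrr /= raddf0.
have [|L2 L2p I2] := IH; first by move=> h hL; apply: H; rewrite inE hL orbT.
have [L1 L1p I1] := H e (mem_head _ _).
exists ([seq (e.1 * h.1, h.2) | h <- L1] ++ L2).
  by move=> h; rewrite mem_cat => /orP[/mapP[g /L1p gp ->]|/L2p].
apply: (Tideal_ev F0 HI) (ID _ _ (Tideal_mull HI (QConst e.1) I1) I2) => d A Z.
rewrite qevD qevM qevC !qev_qsub !qev_qcomb big_cat big_map big_cons qev_qmon /=.
rewrite mul_scalar_mx scalerBr scaler_sumr opprD addrACA.
by congr (_ + _ + (- _ - _)); apply: eq_bigr => h _; rewrite scalerA.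
Qed.

(** The reduction [IR], with its letters renamed to the first [p] noncommuting letters of [s], is
    multiplied by the coordinates of [s] on the left and the rest of the word on the right. The new
    words are strictly shorter, so the rewriting ends. *)
Lemma bounded_qmon s :
  exists2 L, bounded p L & I (qsub (qmon F s) (qcomb L)).
Proof.
have [k] := ubnP (wlen s); elim: k s => // k IH s sk.
have [_ I0 ID [_ IMr] IS] := HI.
have [lt|ge] := ltnP (wlen s) p.
  exists [:: (1, s)]; first by move=> e; rewrite inE => /eqP->.
  apply: (Tideal_ev F0 HI) I0 => d A Z.
  by rewrite qev_qsub qev_qcomb big_seq1 qev_qmon scale1r subrr /= raddf0.
pose w := [seq x.2 | x : slot n <- s & x.1 == None].
have sw : size w = wlen s by rewrite size_map size_filter.
pose w1 := take p w; pose w2 : seq (slot n) := [seq (None, j) | j <- drop p w].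
have sw1 : size w1 = p by rewrite size_takel // sw.
pose cs := [seq x <- s | x.1 != None].
pose ren (y : slot n) : slot n := (y.1, nth 0%N w1 y.2).
pose L := [seq (e.1, cs ++ (map ren e.2 ++ w2)) | e <- LR].
have IL : I (qsub (qmon F s) (qcomb L)).
  pose H (j : nat) : qterm F n := QVar (nth 0%N w1 j).
  have I1 := IMr _ (qmon F w2) (Tideal_mull HI (qmon F cs) (IS H _ IR)).
  apply: (Tideal_ev F0 HI) I1 => d A Z.
  have evv (o : option ('I_n * 'I_n)) j : vatom (fun j => qeval A (H j)) (fun j => qev A Z (H j)) o j
      = vatom A Z o (nth 0%N w1 j) by case: o.
  rewrite 2!qevM qev_qsubst !qev_qsub !qev_qmon !qev_qcomb.
  rewrite mulmxBr mulmxBl; congr (_ - _).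
    rewrite [RHS]mon_split [X in X *m _ *m _]big_filter -mulmxA; congr (_ * _).
    rewrite !big_map -[LHS]/(_ * _).
    rewrite -[in RHS]big_filter -[RHS](big_map (fun x : slot n => x.2) xpredT Z) -/w.
    rewrite -[in RHS](cat_take_drop p w) -/w1 big_cat; congr (_ * _).
    rewrite [LHS](eq_bigr (fun j => Z (nth 0%N w1 j))) //.
    by rewrite [RHS](big_nth 0%N) sw1 /index_iota subn0.
  rewrite mulmx_sumr mulmx_suml [RHS]big_map /=; apply: eq_bigr => e _.
  rewrite -scalemxAr -scalemxAl !big_cat /= -mulmxA; congr (_ *: _); congr (_ * _); congr (_ * _).
  by rewrite big_map; apply: eq_bigr => y _; rewrite evv.
have [|L1 L1p I1] := @bounded_qcomb L.
  move=> _ /mapP[e eL ->] /=; apply: IH.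
  rewrite ltnS in sk; apply: leq_trans sk; rewrite /wlen !count_cat.
  have -> : count (fun x : slot n => x.1 == None) cs = 0%N.
    rewrite count_filter; apply/eqP; rewrite -leqn0 leqNgt -has_count.
    by apply/hasPn => x _ /=; case: eqP.
  have -> : count (fun x : slot n => x.1 == None) w2 = (wlen s - p)%N.
    by rewrite count_map (eq_count (a2 := predT)) // count_predT size_drop sw.
  rewrite add0n count_map -/(wlen s) -[X in (_ < X)%N](subnKC ge) ltn_add2r.
  exact: (LRp eL).
exists L1 => //; apply: (Tideal_ev F0 HI) (ID _ _ IL I1) => d A Z.
by rewrite qevD !qev_qsub addrA subrK.
Qed.

Lemma bounded_qterm t : exists2 L, bounded p L & I (qsub t (qcomb L)).
Proof.
have [L tL] := qterm_qcomb t.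
have [e _|L1 L1p I1] := @bounded_qcomb L; first exact: bounded_qmon.
exists L1 => //; apply: (Tideal_ev F0 HI) I1 => d A Z.
by rewrite !qev_qsub tL.
Qed.

End Bounded.

Lemma wlen_enum m (th : 'I_m -> option ('I_n * 'I_n)) l :
  wlen [seq (th i, l i) | i <- enum 'I_m] = #|[set i | th i == None]|.
Proof.
by rewrite /wlen count_map -sum1_count big_enum_cond sum1dep_card.
Qed.

(** Scaling all matrices by [u] multiplies a monomial with k slots by u^k; the result vanishes for
    every [u] in an infinite field, hence so does each coefficient. *)
Lemma quasi_identity_homogeneous (L : seq (F * seq (slot n))) m : quasi_identity (qcomb L) ->
  quasi_identity (qcomb [seq e <- L | size e.2 == m]).
Proof.
move=> qL A; rewrite qeval_qev qev_qcomb.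
apply/matrixP => a b; rewrite summxE mxE.
pose P : {poly F} := \sum_(e <- L)
  (e.1 * (\prod_(x <- e.2) vatom A A x.1 x.2) a b) *: 'X^(size e.2).
have P0 : P = 0.
  apply: (poly_ext0 F0) => u; rewrite horner_sum.
  have := qL (fun k => u *: A k); rewrite qeval_qev qev_qcomb => /matrixP/(_ a b).
  rewrite summxE mxE => E0; rewrite -[RHS]E0; apply: eq_bigr => e _.
  rewrite hornerZ hornerXn mxE -mulrA; congr (_ * _).
  suff -> : \prod_(x <- e.2) vatom (fun k => u *: A k) (fun k => u *: A k) x.1 x.2 =
      u ^+ size e.2 *: \prod_(x <- e.2) vatom A A x.1 x.2 by rewrite mxE mulrC.
  elim: e.2 => [|[o k] s IH]; first by rewrite !big_nil scale1r.
  rewrite !big_cons IH /= exprS -scalerA -[LHS]/(_ *m _) -scalemxAr.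
  rewrite scalerA mulrC -scalerA; congr (_ *: _).
  rewrite [RHS](scalemxAl u (vatom A A o k)); congr (_ *m _).
  by case: o => [ij|] //=; rewrite mxE scale_scalar_mx.
have := congr1 (fun q : {poly F} => q`_m) P0; rewrite coef0 coef_sum => E0.
rewrite -[RHS]E0 big_filter big_mkcond; apply: eq_bigr => e _ /=.
by rewrite coefZ coefXn eq_sym; case: eqP => _; rewrite ?mxE ?mulr1 ?mulr0.
Qed.

Lemma qcomb_qlin m (L : seq (F * seq (slot n))) : (forall e, e \in L -> size e.2 = m) ->
  let x0 : F * seq (slot n) := (0, [::]) in
  let s0 : slot n := (None, 0%N) in
  forall d A (Z : nat -> 'M[F]_d), qev A Z (qcomb L) =
    qev A Z (qlin (fun e : 'I_(size L) => (nth x0 L e).1)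
     (fun e (i : 'I_m) => (nth s0 (nth x0 L e).2 i).1)
     (fun e (i : 'I_m) => (nth s0 (nth x0 L e).2 i).2)).
Proof.
move=> Lm x0 s0 d A Z; rewrite qev_qlin qev_qcomb (big_nth x0) big_mkord.
apply: eq_bigr => e _; congr (_ *: _).
by rewrite (big_nth s0) (Lm _ (mem_nth _ (ltn_ord e))) big_mkord.
Qed.

Lemma wlen_card m s : size s = m ->
  wlen s = #|[set i : 'I_m | (nth (None, 0%N) s i).1 == None]|.
Proof.
move=> sm; rewrite /wlen -sum1_count (big_nth (None, 0%N)) sm big_mkord.
by rewrite sum1dep_card.
Qed.

End Assembly.

(** * Finite generation *)

Lemma iter_evC (F : fieldType) (a : nat -> F) k (c : iter_poly F k) :
  iter_ev a k.+1 c%:P = iter_ev a k c.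
Proof. by rewrite /= /horner_eval map_polyC hornerC. Qed.

Lemma iter_evX (F : fieldType) (a : nat -> F) k :
  iter_ev a k.+1 'X = a k.
Proof. by rewrite /= /horner_eval map_polyX hornerX. Qed.

Section Generators.
Variables (F : fieldType) (n r p : nat).
Hypotheses (F0 : [pchar F] =i pred0) (n_gt0 : (0 < n)%N) (r_gt0 : (0 < r)%N).
Implicit Types (t : qterm F n) (A : nat -> 'M[F]_n).

Local Notation coords := ('I_r * 'I_n * 'I_n)%type.
Local Notation K := #|{: coords}|.
Local Notation words := {: p.-bseq 'I_r}.
Local Notation R := (iter_poly F K).

Definition coord0 : coords := (Ordinal r_gt0, Ordinal n_gt0, Ordinal n_gt0).

Definition coord (i : nat) : coords := nth coord0 (enum {: coords}) i.

Definition coord_val A (i : nat) : F := A (coord i).1.1 (coord i).1.2 (coord i).2.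

Definition letters_lt t := all (fun k => (k < r)%N) (qvars t).

Lemma iter_poly_term k (q : iter_poly F k) : exists2 t, letters_lt t &
  forall d A (Z : nat -> 'M[F]_d), qev A Z t = (iter_ev (coord_val A) k q)%:M.
Proof.
elim: k q => [|k IH] q; first by exists (QConst q).
elim/poly_ind: q => [|q c [t1 t1r t1E]].
  by exists (QConst 0) => // d A Z; rewrite rmorph0.
have [t2 t2r t2E] := IH c.
exists (QAdd (QMul t1 (QCoord (coord k).1.1 (coord k).1.2 (coord k).2)) t2).
  by rewrite /letters_lt /= !all_cat /= -/(letters_lt t1) -/(letters_lt t2) t1r t2r ltn_ord.
move=> d A Z; rewrite qevD qevM t1E t2E rmorphD rmorphM iter_evX iter_evC.
by rewrite raddfD /= scalar_mxM.
Qed.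

Lemma coord_poly (x : coords) : exists q : R, forall A,
  iter_ev (coord_val A) K q = A x.1.1 x.1.2 x.2.
Proof.
have [|q qE] := @iter_poly_var F K (enum_rank x); first exact: ltn_ord.
exists q => A; rewrite qE /coord_val /coord.
by have := nth_enum_rank coord0 x => ->.
Qed.

Definition word_val d (Z : nat -> 'M[F]_d) (w : words) := wval Z [seq nat_of_ord k | k <- w].

(** Rows model the free [R]-module on the words of length at most [p] in [r] letters, one column per
    word. *)
Definition row_val d A (Z : nat -> 'M[F]_d) (v : 'rV[R]_(#|words|)) : 'M[F]_d :=
  \sum_(w : words) iter_ev (coord_val A) K (v 0 (enum_rank w)) *: word_val Z w.

Lemma row_val0 d A (Z : nat -> 'M[F]_d) : row_val A Z 0 = 0.
Proof. by rewrite /row_val big1 // => w _; rewrite mxE rmorph0 scale0r. Qed.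

Lemma row_valD d A (Z : nat -> 'M[F]_d) c v u :
  row_val A Z (c *: v + u) =
  iter_ev (coord_val A) K c *: row_val A Z v + row_val A Z u.
Proof.
rewrite /row_val scaler_sumr -big_split; apply: eq_bigr => w _ /=.
by rewrite !mxE rmorphD rmorphM scalerDl scalerA.
Qed.

Lemma word_term (w : words) : exists2 t, letters_lt t &
  forall d A (Z : nat -> 'M[F]_d), qev A Z t = word_val Z w.
Proof.
rewrite /word_val; elim: (w : seq _) => [|k s [t tr tE]].
  by exists (QConst 1) => // d A Z; rewrite /wval big_nil.
exists (QMul (QVar k) t); first by rewrite /letters_lt /= ltn_ord.
by move=> d A Z; rewrite qevM tE /wval /= big_cons.
Qed.

Lemma row_term v : exists2 t, letters_lt t &
  forall d A (Z : nat -> 'M[F]_d), qev A Z t = row_val A Z v.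
Proof.
rewrite /row_val; elim: (index_enum _) => [|w s [t tr tE]].
  by exists (QConst 0) => // d A Z; rewrite big_nil /= raddf0.
have [t1 t1r t1E] := iter_poly_term (v 0 (enum_rank w)).
have [t2 t2r t2E] := word_term w.
exists (QAdd (QMul t1 t2) t).
  by rewrite /letters_lt /= !all_cat -!/(letters_lt _) t1r t2r tr.
by move=> d A Z; rewrite qevD qevM t1E t2E tE big_cons mul_scalar_mx.
Qed.

Lemma qmon_row (s : seq (slot n)) :
  (forall x, x \in s -> (x.2 < r)%N) -> (wlen s < p)%N ->
  exists v, forall d A (Z : nat -> 'M[F]_d), qev A Z (qmon F s) = row_val A Z v.
Proof.
move=> sr sp.
have [q qE] : exists q : R, forall A, iter_ev (coord_val A) K q =
    \prod_(x <- s) (if x.1 is Some ij then A x.2 ij.1 ij.2 else 1).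
  elim: s sr {sp} => [|[o k] s IH] sr.
    by exists 1 => A; rewrite big_nil rmorph1.
  have [|q qE] := IH; first by move=> x xs; apply: sr; rewrite inE xs orbT.
  have kr : (k < r)%N by have := sr _ (mem_head _ _).
  have [c cE] : exists c : R, forall A, iter_ev (coord_val A) K c =
      (if o is Some ij then A k ij.1 ij.2 else 1).
    case: o {sr} => [ij|]; last by exists 1 => A; rewrite rmorph1.
    by have [c cE] := coord_poly (Ordinal kr, ij.1, ij.2); exists c.
  by exists (c * q) => A; rewrite big_cons rmorphM qE cE.
pose w0 := [seq x.2 | x : slot n <- s & x.1 == None].
pose w1 := [seq insubd (Ordinal r_gt0) k | k <- w0].
have sw1 : (size w1 <= p)%N by rewrite !size_map size_filter ltnW.
pose w : words := Bseq sw1.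
have wE : [seq nat_of_ord k | k <- w] = w0.
  rewrite /= /w1 -map_comp -[RHS]map_id; apply/eq_in_map => k /mapP[x].
  rewrite mem_filter => /andP[_ /sr xr] -> /=.
  by rewrite val_insubd xr.
exists (\row_j (if j == enum_rank w then q else 0)) => d A Z.
rewrite qev_qmon mon_split vatom_coords_scalar -qE /row_val (bigD1 w) //=.
rewrite [X in _ = _ + X]big1 ?addr0 => [|u uw]; last first.
  by rewrite mxE (inj_eq enum_rank_inj) (negPf uw) rmorph0 scale0r.
rewrite mxE eqxx -[LHS]/(_ *m _) mul_scalar_mx; congr (_ *: _).
by rewrite /word_val wE /wval big_map big_filter.
Qed.

Lemma qcomb_row (L : seq (F * seq (slot n))) :
  (forall e x, e \in L -> x \in e.2 -> (x.2 < r)%N) -> bounded p L ->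
  exists v, forall d A (Z : nat -> 'M[F]_d), qev A Z (qcomb L) = row_val A Z v.
Proof.
elim: L => [|e L IH] Lr Lp.
  by exists 0 => d A Z; rewrite qev_qcomb big_nil row_val0.
have [|| v vE] := IH.
- by move=> h x hL; apply: Lr; rewrite inE hL orbT.
- by move=> h hL; apply: Lp; rewrite inE hL orbT.
have [||u uE] := @qmon_row e.2.
- by move=> x; apply: Lr; rewrite mem_head.
- by apply: Lp; rewrite mem_head.
have [c cE] : exists c : R, forall A, iter_ev (coord_val A) K c = e.1.
  elim: (K) => [|k [c cE]]; first by exists e.1.
  by exists c%:P => A; rewrite iter_evC.
exists (c *: u + v) => d A Z; rewrite row_valD cE -uE -vE.
by rewrite qevD qevM qevC mul_scalar_mx.
Qed.

(** The rows that vanish under the coupled evaluation form a submodule of a noetherian module. Terms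
    representing its generators suffice, as the coefficients in [R] are themselves represented by
    terms. *)
Theorem bounded_generators : exists S : seq (qterm F n),
  (forall s, List.In s S -> letters_lt s /\ quasi_identity s) /\
  forall I : qterm F n -> Prop, is_Tideal I -> (forall s, List.In s S -> I s) ->
  forall L : seq (F * seq (slot n)), (forall e x, e \in L -> x \in e.2 -> (x.2 < r)%N) -> bounded p L ->
    quasi_identity (qcomb L) -> I (qcomb L).
Proof.
pose P v := forall A, row_val A A v = 0.
have PS : submodule P.
  split=> [A|c x y Px Py A]; first by rewrite row_val0.
  by rewrite row_valD Px Py scaler0 addr0.
have [g [gP gspan]] := noetherian_rV (@noetherian_iter_poly F K) PS.
have [S [SP Sg]] : exists S : seq (qterm F n),
    (forall s, List.In s S -> letters_lt s /\ quasi_identity s) /\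
    forall v, v \in g -> exists2 s, List.In s S &
      forall d A (Z : nat -> 'M[F]_d), qev A Z s = row_val A Z v.
  elim: g gP {gspan} => [|v g IH] gP; first by exists [::].
  have [|S [SP Sg]] := IH; first by move=> u ug; apply: gP; rewrite inE ug orbT.
  have [t tr tE] := row_term v.
  exists (t :: S); split=> [s /= [<-|/SP//]|u].
    by split=> // A; rewrite qeval_qev tE; apply: gP; rewrite mem_head.
  rewrite inE => /orP[/eqP->|/Sg[s sS sE]]; first by exists t => //; left.
  by exists s => //; right.
exists S; split=> // I HI SI L Lr Lp qL.
have [v vE] := qcomb_row Lr Lp.
have : P v by move=> A; rewrite -vE -qeval_qev.
(* Generalised to every term with the same evaluations as the row, since a partial sum of the span
   is represented by some other term. *)
move=> /gspan; move: (qcomb L) vE => t tE vg; elim: vg t tE => [|c h u hg _ IH] t tE.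
  case: (HI) => _ I0 _ _ _; apply: (Tideal_ev F0 HI) I0 => d A Z.
  by rewrite tE row_val0 /= raddf0.
have [s sS sE] := Sg h hg; have [t1 _ t1E] := iter_poly_term c.
have [t2 _ t2E] := row_term u.
case: (HI) => _ _ ID _ _.
apply: (Tideal_ev F0 HI) (ID _ _ (Tideal_mull HI t1 (SI _ sS)) (IH t2 t2E)) => d A Z.
by rewrite qevD qevM t1E t2E sE tE row_valD mul_scalar_mx.
Qed.

End Generators.

Theorem mainTheorem19 (F : fieldType) (n : nat) :
  [pchar F] =i pred0 -> (1 <= n)%N ->
  exists S : seq (qterm F n),
    (forall s, List.In s S -> (size (undup (qvars s)) <= 2 * n ^ 2)%N) /\
    (forall t : qterm F n,
        Tgen (fun s => List.In s S) t <-> quasi_identity t).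
Proof.
move=> F0 n_gt0; pose N := (n * n)%N; pose r := (2 * n ^ 2)%N.
have rN : r = (N + N)%N by rewrite /r mul2n -addnn expnS expn1.
have r_gt0 : (0 < r)%N by rewrite muln_gt0 expn_gt0 n_gt0.
have [LR [LRP LRE]] := razmyslov_reduction F0 n_gt0.
have [G [GP GI]] := bounded_generators N F0 n_gt0 r_gt0.
pose T := qsub (qmon F [seq (None, k) | k <- iota 0 N]) (qcomb LR).
have card_letters s : letters_lt r s -> (size (undup (qvars s)) <= r)%N.
  move=> /allP sr; rewrite -[X in (_ <= X)%N](size_iota 0).
  by apply: uniq_leq_size (undup_uniq _) _ => k; rewrite mem_undup mem_iota => /sr.
have qT : quasi_identity T.
  move=> A; rewrite qeval_qev qev_qsub qev_qmon qev_qcomb.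
  by apply/eqP; rewrite subr_eq0 -LRE big_map.
have letters_qmon (s : seq (slot n)) : (forall x, x \in s -> (x.2 < r)%N) ->
    letters_lt r (qmon F s).
  elim: s => // -[o k] s IH sr; rewrite /letters_lt /= all_cat.
  rewrite [all _ (qvars (qmon F s))]IH ?andbT; last first.
    by move=> x xs; apply: sr; rewrite inE xs orbT.
  by have := sr _ (mem_head _ _); case: o {sr} => [ij|] /= ->.
have Nr : (N <= r)%N by rewrite rN leq_addr.
have TL : letters_lt r T.
  rewrite /letters_lt /= all_cat; apply/andP; split.
    apply: letters_qmon => x /mapP[k]; rewrite mem_iota => /andP[_ kN] -> /=.
    exact: leq_trans kN Nr.
  elim: LR LRP {LRE T qT} => // e LR IH LRP; rewrite /= all_cat.
  apply/andP; split; last by apply: IH => h hL; apply: LRP; rewrite inE hL orbT.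
  apply: letters_qmon => x xe; have [_ H] := LRP e (mem_head _ _).
  exact: leq_trans (H x xe) Nr.
exists (T :: G); split=> [s /= [<-|/GP[sr _]]|t]; rewrite ?card_letters //.
split=> [H|qt].
  apply: H; first exact: quasi_identity_Tideal.
  by move=> s /= [<-//|/GP[]].
move=> I HI SI.
(* Rewriting inside the quasi-identities of [I] ensures that the difference of [t] and its short
   form is a quasi-identity; hence so is the short form. *)
pose I' t := I t /\ quasi_identity t.
have HI' : is_Tideal I'.
  have [I1 I2 I3 [I4 I4'] I5] := HI.
  have [Q1 Q2 Q3 [Q4 Q4'] Q5] := quasi_identity_Tideal F n.
  split=> [a b e [Ia Qa]||a b [Ia Qa] [Ib Qb]||H a [Ia Qa]].
  - by split; [exact: I1 e Ia | exact: Q1 e Qa].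
  - by split.
  - by split; [exact: I3 | exact: Q3].
  - by split=> a b [Ia Qa]; split; [exact: I4 | exact: Q4 | exact: I4' | exact: Q4'].
  by split; [exact: I5 | exact: Q5].
have LRb : bounded N LR by move=> e /LRP[].
have IT : I' T by split=> //; apply: SI; left.
have [L Lp [ItL qtL]] := bounded_qterm F0 HI' LRb IT t.
have qL : quasi_identity (qcomb L).
  move=> A; have := qtL A; rewrite !qeval_qev qev_qsub -[qev A A t]qeval_qev qt sub0r.
  by move/eqP; rewrite oppr_eq0 => /eqP.
have small m (E : finType) (a : E -> F) (th : E -> 'I_m -> option ('I_n * 'I_n)) l :
    (forall e s, (l e s < r)%N) -> (forall e, #|[set s | th e s == None]| < N)%N ->
    quasi_identity (qlin a th l) -> I (qlin a th l).
  move=> lr thN; apply: (GI I HI) => [s sG|e x /mapP[h _ ->] /mapP[i _ ->]|e /mapP[h _ ->]] //=.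
    by apply: SI; right.
  by rewrite wlen_enum.
have homog m : I (qcomb [seq e <- L | size e.2 == m]).
  set Lm := [seq _ <- _ | _].
  have Lm_size e : e \in Lm -> size e.2 = m by rewrite mem_filter => /andP[/eqP].
  have E := qcomb_qlin Lm_size.
  apply: (Tideal_ev F0 HI (fun d A Z => esym (E d A Z))).
  apply: (homogeneous_reduction F0 HI (p := N) (r := r)) => //.
  - by rewrite rN.
  - move=> e; rewrite -(wlen_card (Lm_size _ (mem_nth _ (ltn_ord e)))).
    by apply: Lp; have := mem_nth (0, [::]) (ltn_ord e); rewrite mem_filter => /andP[].
  move=> A; rewrite qeval_qev -E -qeval_qev.
  exact: quasi_identity_homogeneous.
have IL : I (qcomb L).
  (* Every monomial of [L] has fewer than [B] slots, so [L] is the sum of its components of degree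
     below [B]. *)
  pose B := (\max_(e <- L) size e.2).+1.
  have := @Tideal_qsum_fin _ _ _ HI 'I_B (fun m => qcomb [seq e <- L | size e.2 == m])
    (fun m => homog m).
  apply: (Tideal_ev F0 HI) => d A Z.
  rewrite qev_qsum big_map big_enum qev_qcomb /=.
  under eq_bigr => m _ do rewrite qev_qcomb big_filter big_mkcond.
  rewrite exchange_big big_seq [RHS]big_seq; apply: eq_bigr => e eL /=.
  have eB : (size e.2 < B)%N by rewrite ltnS (big_rem e eL) leq_maxl.
  by rewrite -big_mkcond (big_pred1 (Ordinal eB)) // => m; rewrite eq_sym.
have [_ _ ID _ _] := HI.
apply: (Tideal_ev F0 HI) (ID _ _ ItL IL) => d A Z.
by rewrite qevD qev_qsub subrK.
Qed.
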